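(* There exist universal constants $C_0,D_1,D_2,\gamma>0$ and, for every integer $p\ge 2$, a constant $C_p$ depending only on $p$, such that the following holds. Let $0<q<1$, let $\Theta$ be a positive integer, let $I=[a,b]$, and let $\nu$ be a probability measure on $I$ with density $\nu(x)$. Let $N,m,s$ be positive integers and $K\ge 1$ with $$m\ge C_0 K^2 s\log^3(s)\log(N+1).$$ Let $\{\psi_0,\psi_1,\dots,\psi_N\}$ be polynomials on $I$ that are orthonormal with respect to $\nu$, whose degrees are strictly increasing and do not exceed $N$, and that are uniformly bounded: $\|\psi_k\|_\infty\le K$ for $k=0,\dots,N$. Let $x_1,\dots,x_m$ be drawn independently from $I$, each with probability density $\nu(x)$, and let $A\in\mathbb{R}^{m\times(N+1)}$ have entries $A_{j,k}=\psi_k(x_j)$, $j=1,\dots,m$, $k=0,\dots,N$. Let $p\ge 2$ be an integer, let $f$ be a function on $[a,b]$ having a bounded $p$-th derivative $f^{(p)}$ with $|f^{(p)}(x)|\le M_p$ on $[a,b]$, and put $\mathbf{y}=(f(x_1),\dots,f(x_m))^T$. Then, with probability at least $1-(N+1)^{-\gamma\log^3(s)}$, the following holds: if $\mathbf{c}^\#=(c_0^\#,\dots,c_N^\#)^T$ is a solution of $$\min_{\mathbf{z}\in\mathbb{R}^{N+1}}\|\mathbf{z}\|_1\quad\text{subject to}\quad \|A\mathbf{z}-\mathbf{y}\|_2\le\Theta\sqrt{m}\,E_N,$$ and $p^\#(x)=\sum_{k=0}^N c_k^\#\psi_k(x)$, then $$\|f-p^\#\|_\infty\le K D_1\|p_{opt}\|_{A_q}s^{1-\frac1q}+C_p(b-a)^pM_p\left(K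 D_2\Theta+1\right)\frac{\sqrt{s}}{N^p}.$$ Here $p_{opt}$ is the best uniform approximation polynomial of $f$ in $\Pi_N(I)=\mathrm{span}\{\psi_0,\dots,\psi_N\}$ and $E_N$ is the best uniform approximation error of $f$ in $\Pi_N(I)$.
   Context: $\|g\|_\infty=\max_{x\in[a,b]}|g(x)|$ for continuous $g$ on $[a,b]$. $\Pi_N(I)$ is the space of polynomials on $I$ of degree at most $N$. $E_N=E_N(f)=\inf_{r\in\Pi_N(I)}\|f-r\|_\infty$, and $p_{opt}\in\Pi_N(I)$ satisfies $\|f-p_{opt}\|_\infty=E_N$. Orthonormal with respect to $\nu$ means $\int_I\psi_j(x)\psi_k(x)\nu(x)\,dx=\delta_{jk}$. For a vector $\mathbf{z}$, $\|\mathbf{z}\|_r=(\sum_j|z_j|^r)^{1/r}$ for $0<r<\infty$. For $g=\sum_{k=0}^N c_k\psi_k$, $\|g\|_{A_q}:=\|\mathbf{c}\|_q$, $q>0$. The integer $p$ (order of smoothness) is unrelated to the polynomials $p^\#$, $p_{opt}$. ''Universal constants'' means independent of all the other data.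
   Formalization: The formal theorem adds the assumption p ≤ N+1; without it the claim fails: for N < p−1 and s ≥ 2, f the shifted Chebyshev polynomial of degree N+1 has M_p = 0 and p_opt = 0, so the bound is 0 while the minimizer is 0 and the error is positive. *)

(* Defs.v *)
From HB Require Import structures.
From mathcomp Require Import all_boot all_order all_algebra.
From mathcomp Require Import all_classical all_reals all_analysis.
Set Implicit Arguments.
Unset Strict Implicit.
Unset Printing Implicit Defensive.
Import Order.TTheory GRing.Theory Num.Theory.
Import numFieldNormedType.Exports.
Local Open Scope classical_set_scope.
Local Open Scope ring_scope.

(* For g continuous on [a, b] the supremum is the maximum. For g unbounded on
   [a, b] the value is the junk value of [sup]. *)
Definition norm_infty {R : realType} (a b : R) (g : R -> R) : R :=
  sup [set `|g x| | x in `[a, b]].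

(* [size r] is 1 + deg r, so [size r <= N.+1] says that deg r <= N. *)
Definition best_error {R : realType} (a b : R) (N : nat) (f : R -> R) : R :=
  inf [set norm_infty a b (fun x => f x - r.[x])
      | r in [set r : {poly R} | (size r <= N.+1)%N]].

Definition best_approx {R : realType} (a b : R) (N : nat) (f : R -> R)
    (r : {poly R}) : Prop :=
  (size r <= N.+1)%N /\
  norm_infty a b (fun x => f x - r.[x]) = best_error a b N f.

Definition vnorm {R : realType} (r : R) (n : nat) (z : 'cV[R]_n) : R :=
  (\sum_(j < n) `|z j 0| `^ r) `^ r^-1.

Definition lincomb {R : realType} (n : nat) (psi : 'I_n -> {poly R})
    (c : 'cV[R]_n) : {poly R} :=
  \sum_(k < n) c k 0 *: psi k.

(* The coefficients of g on psi; the junk value 0 is only taken when g is not in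
   the span of psi. They are unique when psi is linearly independent. *)
Definition coefs {R : realType} (n : nat) (psi : 'I_n -> {poly R})
    (g : {poly R}) : 'cV[R]_n :=
  xget 0 [set c : 'cV[R]_n | g = lincomb psi c].

Definition Anorm {R : realType} (n : nat) (psi : 'I_n -> {poly R}) (q : R)
    (g : {poly R}) : R :=
  vnorm q (coefs psi g).

Definition prob_density {R : realType} (a b : R) (nu : R -> R) : Prop :=
  [/\ measurable_fun `[a, b] nu,
      (forall x, x \in `[a, b] -> 0 <= nu x) &
      (\int[lebesgue_measure]_(x in `[a, b]) (nu x)%:E = 1)%E].

Definition orthonormal_wrt {R : realType} (a b : R) (nu : R -> R) (n : nat)
    (psi : 'I_n -> {poly R}) : Prop :=
  forall j k : 'I_n,
    (\int[lebesgue_measure]_(x in `[a, b])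
        ((psi j).[x] * (psi k).[x] * nu x)%:E = ((j == k)%:R)%:E)%E.

Definition has_density {R : realType} {d : measure_display}
    {T : measurableType d} {P : probability T R} (a b : R) (nu : R -> R)
    (X : {RV P >-> R}) : Prop :=
  forall B : set R, measurable B ->
    distribution P X B =
    (\int[lebesgue_measure]_(x in B `&` `[a, b]) (nu x)%:E)%E.

Definition mutually_independent {R : realType} {d : measure_display}
    {T : measurableType d} {P : probability T R} (m : nat)
    (X : 'I_m -> {RV P >-> R}) : Prop :=
  forall (J : {set 'I_m}) (B : 'I_m -> set R),
    (forall j, measurable (B j)) ->
    P (\bigcap_(j in [set` J]) (X j @^-1` B j)) =
    (\prod_(j in J) P (X j @^-1` B j))%E.

(* "G has probability at least t", without assuming G to be measurable. *)
Definition prob_at_least {R : realType} {d : measure_display}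
    {T : measurableType d} (P : probability T R) (G : set T) (t : R) : Prop :=
  exists E : set T, [/\ measurable E, E `<=` G & (t%:E <= P E)%E].

Definition sampling_mx {R : realType} (m n : nat) (psi : 'I_n -> {poly R})
    (x : 'I_m -> R) : 'M[R]_(m, n) :=
  \matrix_(j < m, k < n) (psi k).[x j].

Definition sample_vec {R : realType} (m : nat) (f : R -> R) (x : 'I_m -> R) :
    'cV[R]_m :=
  \col_(j < m) f (x j).

Definition l1_solution {R : realType} (m n : nat) (A : 'M[R]_(m, n))
    (y : 'cV[R]_m) (eta : R) (c : 'cV[R]_n) : Prop :=
  vnorm 2 (A *m c - y) <= eta /\
  forall z : 'cV[R]_n, vnorm 2 (A *m z - y) <= eta -> vnorm 1 c <= vnorm 1 z.

(* g' is the derivative on [a, b] of the restriction of g to [a, b]: the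
   derivative is one-sided at a and b, and values of g off [a, b] do not
   matter. *)
Definition derivative_on {R : realType} (a b : R) (g g' : R -> R) : Prop :=
  forall x, x \in `[a, b] ->
    (g y - g x) / (y - x) @[y --> within `[a, b] x^'] --> g' x.

Fixpoint nth_derivative_on {R : realType} (a b : R) (p : nat) (g gp : R -> R)
    : Prop :=
  match p with
  | 0%N => forall x, x \in `[a, b] -> gp x = g x
  | p'.+1 => exists2 g1 : R -> R,
      derivative_on a b g g1 & nth_derivative_on a b p' g1 gp
  end.

(* Main.v *)
Require Import Defs.
From HB Require Import structures.
From mathcomp Require Import all_boot all_order all_algebra.
From mathcomp Require Import all_classical all_reals all_analysis.
From mathcomp Require Import finmap measurable_realfun.
From mathcomp Require Import ring lra zify.
Set Implicit Arguments.
Unset Strict Implicit.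
Unset Printing Implicit Defensive.
Import Order.TTheory GRing.Theory Num.Theory.
Import numFieldNormedType.Exports.
Local Open Scope classical_set_scope.
Local Open Scope ring_scope.

(** The error [e] between a minimizer and the coefficients of the best
    approximation satisfies an l1 cone condition and has a small image under the
    sampling matrix; it is then controlled in l1 norm, hence the polynomial is
    controlled in uniform norm, as soon as the matrix is bounded below on all
    vectors whose l1/l2 ratio is at most [4 sqrt s]. Jackson's inequality
    converts the best approximation error into the power of [N].

    Only this one-sided bound is needed, not the full restricted isometry
    property, and it can be obtained without chaining. Normalize [e] in l1; then
    [g = sum_k e_k psi_k] is a mean of functions [+- psi_k] bounded by [K]. Where
    [|g|] is about [K 2^-i], the average of about [4^i log^2 s] random terms of
    this mean already has the size of [g], outside an event whose probability is
    proportional to the second moment [sum_k |e_k| psi_k(x)^2]; as this moment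
    has mean 1, no logarithm of [K] is lost. There are at most
    [(2N+2)^(4^i log^2 s)] averages at level [i], and the exponential lower tail
    bound for functions bounded by [K^2 4^-i] beats their number. About [log s]
    levels suffice: what lies below the last one is a function truncated at a
    level of order [K / s], for which one more average is accurate in mean
    square. *)

(** * Jackson's inequality *)

(** The three logarithms of $s$ have separate origins. On the cone the normalized error has squared
    l2 norm at least $1/(16s)$, so all losses together must stay below a constant times $1/s$.
    Misjudging a level costs $2^{-k}$, which forces $k\sim\log s$. An average at level $i$ then has
    about $k^2 4^i$ terms, and the logarithm of the number of averages is about $k^2 4^i\log N$,
    while the exponent of the lower tail is $m\tau 4^i/K^2$ for an additive loss $\tau$. The factors
    $4^i$ cancel, so every level asks for the same $m$; sharing the loss $1/s$ among $L\sim\log s$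
    levels gives $\tau\sim 1/(sL)$, whence $m\sim K^2 s\,L k^2\log N$. The union bound is possible
    because the averages do not depend on the error vector. It enters only through the probabilities
    with which they are drawn, and an inequality valid for every average can be summed with any such
    weights. *)

Section Jackson.
Context {R : realType}.
Implicit Types (x y h c theta : R) (n M : nat).

Fixpoint chebyshev n : {poly R} :=
  match n with
  | 0 => 1
  | n'.+1 => match n' with
             | 0 => 'X
             | n''.+1 => 2%:R *: ('X * chebyshev n') - chebyshev n''
             end
  end.

Lemma chebyshevSS n :
  chebyshev n.+2 = 2%:R *: ('X * chebyshev n.+1) - chebyshev n.
Proof. by []. Qed.

Lemma size_chebyshev n : (size (chebyshev n) <= n.+1)%N.
Proof.
suff: (size (chebyshev n) <= n.+1)%N /\ (size (chebyshev n.+1) <= n.+2)%N by case.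
elim: n => [|n [IH1 IH2]]; first by rewrite /= size_poly1 size_polyX.
split=> //; rewrite chebyshevSS (leq_trans (size_polyD _ _))// geq_max; apply/andP; split.
  apply: (leq_trans (size_scale_leq _ _)).
  by rewrite (leq_trans (size_polyMleq _ _))// size_polyX.
rewrite size_polyN; apply: leq_trans IH1 _; lia.
Qed.

Lemma horner_chebyshev n theta :
  (chebyshev n).[cos theta] = cos (n%:R * theta).
Proof.
suff: (chebyshev n).[cos theta] = cos (n%:R * theta) /\
   (chebyshev n.+1).[cos theta] = cos (n.+1%:R * theta) by case.
elim: n => [|n [IH1 IH2]]; first by rewrite /= hornerC hornerX mul0r cos0 mul1r.
split=> //; rewrite chebyshevSS hornerD hornerN hornerZ hornerM hornerX IH1 IH2.
have -> : n.+2%:R * theta = n.+1%:R * theta + theta by rewrite -[n.+2]addn1 natrD; ring.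
have -> : n%:R * theta = n.+1%:R * theta - theta by rewrite -[n.+1]addn1 natrD; ring.
by rewrite cosB cosD; ring.
Qed.

Lemma sum_cos_arith n c h :
  2%:R * sin (h / 2%:R) * (\sum_(k < n) cos (c + k%:R * h)) =
  sin (c + n%:R * h - h / 2%:R) - sin (c - h / 2%:R).
Proof.
elim: n => [|n IH]; first by rewrite big_ord0 mulr0 mul0r addr0 subrr.
rewrite big_ord_recr /= mulrDr IH.
have -> : c + n.+1%:R * h - h / 2%:R = (c + n%:R * h) + h / 2%:R.
  by rewrite -[n.+1]addn1 natrD; field.
by set u := c + n%:R * h; rewrite sinB [sin (u + _)]sinD; ring.
Qed.

Lemma sin_nat_pi n c : sin (c + n%:R * (pi *+ 2)) = sin c.
Proof. by rewrite mulr_natl periodicn//; exact: sinD2pi. Qed.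

(** Equispaced points of the circle. Averages over them are exact for trigonometric polynomials of
    degree below [M], so the convolution in Jackson's theorem becomes a finite sum. *)
Definition node M (r : nat) : R := r%:R * (pi *+ 2 / M%:R).

Lemma sum_cos_node M l c : (0 < l < M)%N ->
  \sum_(r < M) cos (c + l%:R * node M r) = 0.
Proof.
move=> /andP[l0 lM].
have M0 : M%:R != 0 :> R by rewrite pnatr_eq0; lia.
set h := l%:R * (pi *+ 2 / M%:R) : R.
have hE : h / 2%:R = pi * (l%:R / M%:R) by rewrite /h; field.
have s0 : 0 < sin (h / 2%:R).
  apply: sin_gt0_pi; rewrite hE mulr_gt0 ?pi_gt0 ?divr_gt0 ?ltr0n//=; last lia.
  by rewrite gtr_pMr ?pi_gt0// ltr_pdivrMr ?mul1r ?ltr_nat// ltr0n; lia.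
have := sum_cos_arith M c h.
have -> : c + M%:R * h - h / 2%:R = (c - h / 2%:R) + l%:R * (pi *+ 2).
  by rewrite /h; field.
rewrite sin_nat_pi subrr => /eqP; rewrite mulf_eq0 mulf_eq0 pnatr_eq0 /=.
rewrite (gt_eqF s0)/= => /eqP E; rewrite -[RHS]E; apply: eq_bigr => r _.
by congr (cos (_ + _)); rewrite /h /node; ring.
Qed.

Lemma sum_cos_node_sub M j k c : (j < M)%N -> (k < M)%N ->
  \sum_(r < M) cos (c + (j%:R - k%:R) * node M r) =
  (if j == k then M%:R * cos c else 0).
Proof.
move=> jM kM; case: ifPn => [/eqP->|].
  under eq_bigr do rewrite subrr mul0r addr0.
  by rewrite sumr_const card_ord mulr_natl.
rewrite neq_ltn => /orP[jk|kj].
  under eq_bigr => r _.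
    rewrite -cosN (_ : - (_ + _) = - c + (k - j)%N%:R * node M r); last first.
      by rewrite natrB 1?ltnW//; ring.
    over.
  by apply: sum_cos_node; lia.
under eq_bigr do rewrite -natrB 1?ltnW//.
by apply: sum_cos_node; lia.
Qed.

(** The squared modulus of $\sum_j a_j e^{ij\phi}$, expanded. *)
Definition jkernel n (a : nat -> R) (phi : R) : R :=
  \sum_(j < n) \sum_(k < n) a j * a k * cos ((j%:R - k%:R) * phi).

Lemma jkernel_ge0 n a phi : 0 <= jkernel n a phi.
Proof.
have -> : jkernel n a phi = (\sum_(j < n) a j * cos (j%:R * phi)) ^+ 2 +
    (\sum_(j < n) a j * sin (j%:R * phi)) ^+ 2.
  rewrite !expr2 !big_distrlr -big_split; apply: eq_bigr => j _ /=.
  rewrite -big_split; apply: eq_bigr => k _ /=.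
  by rewrite mulrBl cosB; ring.
by rewrite addr_ge0 ?sqr_ge0.
Qed.

Lemma sum_jkernel n M a c : (n <= M)%N ->
  \sum_(r < M) jkernel n a (c + node M r) = M%:R * \sum_(j < n) a j ^+ 2.
Proof.
move=> nM; rewrite exchange_big/= mulr_sumr; apply: eq_bigr => j _.
rewrite exchange_big/= (bigD1 j)//= [X in _ + X = _]big1 ?addr0 => [|k kj].
  rewrite -mulr_sumr.
  under eq_bigr do rewrite subrr mul0r cos0.
  by rewrite sumr_const card_ord expr2 mulrC.
rewrite -mulr_sumr.
under eq_bigr do rewrite mulrDr.
rewrite sum_cos_node_sub ?(leq_trans _ nM)//.
by rewrite eq_sym val_eqE (negbTE kj) mulr0.
Qed.

(* The sine weights [a] are the eigenvector of the path graph for its top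
   eigenvalue, so that the first Fourier coefficient of the kernel is as close
   to the zeroth one as possible. *)
Lemma sum_jkernel_cos n c :
  let h := pi / n.+1%:R in let a := fun k : nat => sin (k.+1%:R * h) in
  \sum_(r < n.+1) jkernel n a (c + node n.+1 r) * cos (c + node n.+1 r) =
  n.+1%:R * cos h * \sum_(j < n) a j ^+ 2.
Proof.
move=> h a.
have E : forall phi, jkernel n a phi * cos phi =
    \sum_(j < n) a j * (\sum_(k < n) a k / 2%:R *
      (cos ((j.+1%:R - k%:R) * phi) + cos ((j%:R - k.+1%:R) * phi))).
  move=> phi; rewrite mulr_suml; apply: eq_bigr => j _.
  rewrite mulr_suml mulr_sumr; apply: eq_bigr => k _.
  have -> : (j.+1%:R - k%:R) * phi = (j%:R - k%:R) * phi + phi.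
    by rewrite -[j.+1]addn1 natrD; ring.
  have -> : (j%:R - k.+1%:R) * phi = (j%:R - k%:R) * phi - phi.
    by rewrite -[k.+1]addn1 natrD; ring.
  by rewrite cosB cosD; field.
under eq_bigr do rewrite E.
rewrite exchange_big/= mulr_sumr; apply: eq_bigr => j _; rewrite -mulr_sumr.
rewrite exchange_big/=.
under eq_bigr => k _.
  rewrite -mulr_sumr big_split/=.
  under eq_bigr do rewrite mulrDr.
  rewrite sum_cos_node_sub; [|by have := ltn_ord j; lia|by have := ltn_ord k; lia].
  under [X in _ + X]eq_bigr do rewrite mulrDr.
  rewrite sum_cos_node_sub; [|by have := ltn_ord j; lia|by have := ltn_ord k; lia].
  rewrite (_ : (if _ then _ else _) = n.+1%:R * (j.+1 == k)%:R); last first.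
    by case: eqP => [->|]; rewrite ?subrr ?mul0r ?cos0 ?mulr0.
  rewrite (_ : (if _ then _ else _) = n.+1%:R * (j == k.+1 :> nat)%:R); last first.
    by case: eqP => [->|]; rewrite ?subrr ?mul0r ?cos0 ?mulr0.
  rewrite (_ : _ * _ = n.+1%:R / 2%:R * (a k * (j.+1 == k)%:R) +
     n.+1%:R / 2%:R * (a k * (j == k.+1 :> nat)%:R)); last by field.
  over.
rewrite big_split/= -!mulr_sumr.
(* The sum picks the right neighbour of [j]. For the last [j] there is none, and the formula
   survives because $\sin((n+1)h)=\sin\pi=0$; the left end uses $\sin 0=0$ in the same way. *)
have -> : \sum_(k < n) a k * (j.+1 == k)%:R = sin (j.+2%:R * h).
  have [jn|jn] := ltnP j.+1 n.
    rewrite (bigD1 (Ordinal jn))//= eqxx mulr1 big1 ?addr0// => k kj.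
    rewrite (_ : (j.+1 == k) = false) ?mulr0//.
    by apply/negP => /eqP jk; move/eqP: kj; apply; apply/val_inj.
  rewrite big1 => [|k _]; last first.
    by rewrite (_ : (j.+1 == k) = false) ?mulr0//; apply/negP => /eqP; have := ltn_ord k; lia.
  have -> : (j : nat) = n.-1 by have := ltn_ord j; lia.
  have -> : n.-1.+2 = n.+1 by have := ltn_ord j; lia.
  by rewrite /h mulrC divfK ?pnatr_eq0// sinpi.
have -> : \sum_(k < n) a k * (j == k.+1 :> nat)%:R = sin (j%:R * h).
  case: (posnP j) => [->|j0].
    by rewrite mul0r sin0 big1// => k _; rewrite mulr0.
  have jn : (j.-1 < n)%N by have := ltn_ord j; lia.
  rewrite (bigD1 (Ordinal jn))//= prednK// eqxx mulr1 big1 ?addr0 => [|k kj].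
    by rewrite /a prednK.
  rewrite (_ : (j == k.+1 :> nat) = false) ?mulr0//.
  by apply/negP => /eqP jk; move/eqP: kj; apply; apply/val_inj => /=; rewrite jk.
have -> : j.+2%:R * h = j.+1%:R * h + h by rewrite -[j.+2]addn1 natrD; ring.
have -> : j%:R * h = j.+1%:R * h - h by rewrite -[j.+1]addn1 natrD; ring.
by rewrite /a sinB sinD; field.
Qed.

Lemma sin_le x : 0 <= x -> sin x <= x.
Proof.
rewrite le_eqVlt => /predU1P[<-|x0]; first by rewrite sin0.
have [c _] := @MVT R sin cos 0 x x0 (fun y _ => is_derive_sin y)
  (continuous_subspaceT (@continuous_sin R)).
by rewrite sin0 !subr0 => ->; rewrite ler_piMl ?cos_le1 ?ltW.
Qed.

Lemma cos_lb x : 0 <= x -> x <= pi -> 2 - 2 * cos x <= x ^+ 2.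
Proof.
move=> x0 xpi.
have -> : x = (x / 2) *+ 2 by rewrite -mulr_natr divfK.
rewrite cos_mulr2n cos2sin2.
have s0 : 0 <= sin (x / 2) by apply: sin_ge0_pi; apply/andP; split; lra.
have s1 : sin (x / 2) <= x / 2 by apply: sin_le; lra.
have : sin (x / 2) ^+ 2 <= (x / 2) ^+ 2 by rewrite ler_sqr ?nnegrE//; lra.
by rewrite !mulr2n; lra.
Qed.

(** A positive averaging operator: at $x=\cos\theta$ the polynomial is a mean of the values
    [g (cos (t r))] with weights proportional to $D(\theta+t_r)+D(-\theta+t_r)$. Symmetrizing in
    $\theta$ turns each $\cos((j-k)(\theta+t_r))$ into a multiple of $\cos((j-k)\theta)$, a
    Chebyshev polynomial in $x$. The error is governed by the mean square distance, at most $2-2\cos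
    h\le h^2$ with $h=\pi/(n+2)$, and $\pi<4$. *)
Lemma jackson_lipschitz11 (g : R -> R) (L : R) n : 0 <= L ->
  (forall x y, -1 <= x <= 1 -> -1 <= y <= 1 -> `|g x - g y| <= L * `|x - y|) ->
  exists2 r : {poly R}, (size r <= n.+1)%N &
    forall x, -1 <= x <= 1 -> `|g x - r.[x]| <= 4 * L / n.+1%:R.
Proof.
move=> L0 gL.
pose h : R := pi / n.+2%:R; pose a := fun k : nat => sin (k.+1%:R * h) : R.
have h0 : 0 < h by rewrite divr_gt0 ?pi_gt0.
have hpi : h < pi by rewrite ltr_pdivrMr// ltr_pMr ?pi_gt0// ltr1n.
pose A := \sum_(j < n.+1) a j ^+ 2.
have A0 : 0 < A.
  rewrite /A big_ord_recl ltr_pwDl// ?sumr_ge0//; last by move=> *; exact: sqr_ge0.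
  by rewrite exprn_gt0// /a mul1r sin_gt0_pi// h0.
pose t (r : nat) : R := node n.+2 r.
pose D := jkernel n.+1 a.
pose J : {poly R} := \sum_(r < n.+2) (g (cos (t r)) / (n.+2%:R * A)) *:
  \sum_(j < n.+1) \sum_(k < n.+1) (a j * a k * cos ((j%:R - k%:R) * t r)) *:
     chebyshev (maxn j k - minn j k).
exists J.
  apply: (leq_trans (size_sum _ _ _)); apply/bigmax_leqP => r _.
  apply: (leq_trans (size_scale_leq _ _)).
  apply: (leq_trans (size_sum _ _ _)); apply/bigmax_leqP => j _.
  apply: (leq_trans (size_sum _ _ _)); apply/bigmax_leqP => k _.
  apply: (leq_trans (size_scale_leq _ _)).
  apply: (leq_trans (size_chebyshev _)).
  by have := ltn_ord j; have := ltn_ord k; lia.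
move=> x x11; pose th := acos x.
have xE : x = cos th by rewrite acosK// in_itv.
have mA : n.+2%:R * A != 0 by rewrite mulf_neq0 ?pnatr_eq0 ?gt_eqF.
pose w (r : nat) := (D (th + t r) + D (- th + t r)) / (2 * n.+2%:R * A).
have w0 r : 0 <= w r.
  by rewrite divr_ge0 ?addr_ge0 ?jkernel_ge0// !mulr_ge0// ltW.
have JE : J.[x] = \sum_(r < n.+2) w r * g (cos (t r)).
  rewrite /J horner_sum; apply: eq_bigr => r _.
  rewrite hornerZ /w mulrAC [RHS]mulrC mulrA.
  set v := \sum_(j < _) _.
  suff -> : D (th + t r) + D (- th + t r) = 2 * v.[x] by field; rewrite ?mA ?gt_eqF.
  rewrite /D /jkernel -big_split /v horner_sum mulr_sumr; apply: eq_bigr => j _ /=.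
  rewrite -big_split horner_sum mulr_sumr; apply: eq_bigr => k _ /=.
  rewrite hornerZ {1}xE horner_chebyshev.
  have -> : cos ((maxn j k - minn j k)%:R * th) = cos ((j%:R - k%:R) * th).
    have [jk|jk] := leqP j k.
      by rewrite natrB// -cosN; congr cos; ring.
    by rewrite natrB// ltnW.
  rewrite !mulrDr mulrN [- _ + _]addrC cosB cosD; ring.
have w1 : \sum_(r < n.+2) w r = 1.
  rewrite -mulr_suml big_split/= !sum_jkernel// -/A; field.
  by rewrite ?gt_eqF// nat1r -natrD pnatr_eq0.
have w2 : \sum_(r < n.+2) w r * (x - cos (t r)) ^+ 2 <= h ^+ 2.
  apply: le_trans (cos_lb (ltW h0) (ltW hpi)).
  have : \sum_(r < n.+2) (D (th + t r) * (2 - 2 * cos (th + t r)) +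
       D (- th + t r) * (2 - 2 * cos (- th + t r))) / (2 * n.+2%:R * A) =
       2 - 2 * cos h.
    rewrite -mulr_suml big_split/=.
    under eq_bigr do rewrite mulrBr mulrCA [_ * 2]mulrC.
    rewrite sumrB -!mulr_sumr sum_jkernel// sum_jkernel_cos -/A.
    under eq_bigr do rewrite mulrBr mulrCA [_ * 2]mulrC.
    rewrite sumrB -!mulr_sumr sum_jkernel// sum_jkernel_cos -/A -/h.
    field.
    by rewrite ?gt_eqF// nat1r -natrD pnatr_eq0.
  move=> <-; apply: ler_sum => r _; rewrite /w mulrAC ler_pM2r ?invr_gt0 ?mulr_gt0//.
  (* The right sides are the squared chords from $e^{iu}$ to $e^{-iv}$ and to $e^{iv}$; both chords
     have horizontal extent $\cos u-\cos v$. *)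
  have S : forall u v : R, (cos u - cos v) ^+ 2 <= 2 - 2 * cos (u + v) /\
     (cos u - cos v) ^+ 2 <= 2 - 2 * cos (- u + v).
    move=> u v; rewrite cosD [- u + v]addrC cosB.
    have := cos2Dsin2 u; have := cos2Dsin2 v.
    have := sqr_ge0 (sin u - sin v); have := sqr_ge0 (sin u + sin v).
    by move=> *; split; lra.
  rewrite mulrDl xE; apply: lerD; apply: ler_wpM2l; rewrite ?jkernel_ge0//.
    exact: (S _ _).1.
  exact: (S _ _).2.
have -> : g x - J.[x] = \sum_(r < n.+2) w r * (g x - g (cos (t r))).
  under eq_bigr do rewrite mulrBr.
  by rewrite sumrB -mulr_suml w1 mul1r JE.
apply: (@le_trans _ _ (L * h)); last first.
  rewrite [4 * _]mulrC -mulrA ler_wpM2l// /h.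
  apply: (@le_trans _ _ (4 / n.+2%:R)).
    rewrite ler_pM2r ?invr_gt0//.
    by have := @pihalf_lt2 R; lra.
  by rewrite ler_pM2l// lef_pV2 ?posrE// ler_nat.
apply: le_trans (ler_norm_sum _ _ _) _.
have P r : `|w r * (g x - g (cos (t r)))| <=
    L / 2 * (w r * (x - cos (t r)) ^+ 2 / h + w r * h).
  rewrite normrM ger0_norm//.
  apply: (@le_trans _ _ (w r * (L * `|x - cos (t r)|))).
    by apply: ler_wpM2l => //; apply: gL => //; rewrite cos_geN1 cos_le1.
  (* The inequality $|u|\le(u^2/h+h)/2$ passes from the mean square distance to the mean distance,
     in place of Cauchy-Schwarz. *)
  rewrite (_ : L / 2 * _ = w r * (L * (((x - cos (t r)) ^+ 2 / h + h) / 2))); last by ring.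
  apply: ler_wpM2l => //; apply: ler_wpM2l => //.
  set u := x - _; rewrite -[u ^+ 2]real_normK ?num_real//.
  rewrite -subr_ge0 (_ : _ - _ = (`|u| - h) ^+ 2 / (2 * h)); last by field; rewrite gt_eqF.
  by apply: divr_ge0; [exact: sqr_ge0|rewrite mulr_ge0// ltW].
apply: (@le_trans _ _ (\sum_(r < n.+2)
    L / 2 * (w r * (x - cos (t r)) ^+ 2 / h + w r * h))).
  by apply: ler_sum => r _; exact: P.
rewrite -mulr_sumr big_split/= -mulr_suml -[X in _ + X]mulr_suml w1 mul1r.
have : (\sum_(r < n.+2) w r * (x - cos (t r)) ^+ 2) / h <= h.
  by rewrite ler_pdivrMr -?expr2.
move=> H; rewrite -mulrA ler_wpM2l//; lra.
Qed.

Lemma jackson_lipschitz (a b : R) (g : R -> R) (L : R) n : a < b -> 0 <= L ->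
  {in `[a, b] &, forall x y, `|g x - g y| <= L * `|x - y|} ->
  exists2 r : {poly R}, (size r <= n.+1)%N &
    forall x, x \in `[a, b] -> `|g x - r.[x]| <= 2 * (b - a) / n.+1%:R * L.
Proof.
move=> ab L0 gL.
pose u x := (a + b) / 2 + (b - a) / 2 * x.
have uab x : -1 <= x <= 1 -> u x \in `[a, b].
  by move=> /andP[x1 x2]; rewrite in_itv /= /u; apply/andP; split; nra.
have [||r rn rE] := @jackson_lipschitz11 (g \o u) (L * ((b - a) / 2)) n.
- by rewrite mulr_ge0//; lra.
- move=> x y x1 y1; rewrite -mulrA -[X in X * `|_|]gtr0_norm; last by lra.
  rewrite -normrM (_ : _ * (x - y) = u x - u y); last by rewrite /u; ring.
  by apply: gL; apply: uab.
have ba0 : b - a != 0 by rewrite gt_eqF; lra.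
pose q : {poly R} := (- (a + b) / (b - a))%:P + (2 / (b - a)) *: 'X.
exists (r \Po q) => [|x xab].
  have q2 : (size q <= 2)%N.
    rewrite (leq_trans (size_polyD _ _))// geq_max (leq_trans (size_polyC_leq1 _))//=.
    by rewrite (leq_trans (size_scale_leq _ _))// size_polyX.
  rewrite (leq_trans (size_comp_poly_leq _ _))// ltnS.
  by have : ((size r).-1 * (size q).-1 <= n * 1)%N; [apply: leq_mul; lia|lia].
have qx : u q.[x] = x.
  by rewrite /u /q hornerD hornerC hornerZ hornerX; field.
have q11 : -1 <= q.[x] <= 1.
  move: xab; rewrite in_itv/= => /andP[x1 x2].
  have := qx; rewrite /u => E; apply/andP; split; nra.
have := rE _ q11; rewrite horner_comp /= qx; move/le_trans; apply.
by rewrite le_eqVlt; apply/orP; left; apply/eqP; field; rewrite nat1r pnatr_eq0.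
Qed.

Lemma derivative_onP (a b : R) (g g' : R -> R) x : derivative_on a b g g' ->
  x \in `[a, b] -> forall e, 0 < e -> exists2 d, 0 < d &
  forall y, y \in `[a, b] -> `|y - x| < d ->
    `|g y - g x - g' x * (y - x)| <= e * `|y - x|.
Proof.
move=> gd xab e e0; have /cvgrPdist_le/(_ _ e0) := gd _ xab.
rewrite near_withinE near_withinE near_nbhs => /nbhs_ballP[d /= d0 H]; exists d => // y yab yd.
have [->|yx] := eqVneq y x; first by rewrite !subrr mulr0 subr0 normr0 mulr0.
have yx0 : y - x != 0 by rewrite subr_eq0.
have := H y; rewrite /ball /= distrC => /(_ yd yx yab).
rewrite distrC => {}H.
rewrite (_ : _ - _ = ((g y - g x) / (y - x) - g' x) * (y - x)); last by field.
by rewrite normrM ler_wpM2r.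
Qed.

Lemma near_dist_lt (z e : R) : 0 < e -> \forall w \near z, `|w - z| < e.
Proof.
move=> e0; near=> w; have : ball z e w by near: w; exact: nbhsx_ballx.
by rewrite /ball /= distrC.
Unshelve. all: by end_near. Qed.

(** The mean value theorem on [[x, y]]: at an interior point all nearby points lie in [[a, b]], so
    the limit within [[a, b]] is an ordinary derivative, and at the ends only continuity from inside
    is required. *)
Lemma derivative_on_lipschitz (a b : R) (g g' : R -> R) (L : R) :
  derivative_on a b g g' -> (forall x, x \in `[a, b] -> `|g' x| <= L) ->
  {in `[a, b] &, forall x y, `|g x - g y| <= L * `|x - y|}.
Proof.
move=> gd g'L x y; wlog xy : x y / x < y => [hwlog xab yab|xab yab].
  have [->|/lt_total/orP[xy|yx]] := eqVneq x y; first by rewrite !subrr normr0 mulr0.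
  - exact: hwlog.
  - by rewrite distrC [ `|x - y|]distrC; exact: hwlog.
have sub z : z \in `[x, y] -> z \in `[a, b].
  move: xab yab; rewrite !in_itv /= => /andP[ax _] /andP[_ yb] /andP[xz zy].
  by rewrite (le_trans ax xz) (le_trans zy yb).
have dg z : z \in `]x, y[ -> is_derive z 1 g (g' z).
  move=> zxy; have zab : z \in `[a, b] by apply: sub; apply: subset_itv_oo_cc.
  apply/is_derive1_caratheodory.
  exists (fun w => if w == z then g' z else (g w - g z) / (w - z)); split.
  - move=> w; case: eqP => [->|/eqP]; first by rewrite !subrr mulr0.
    by rewrite -subr_eq0 => /divfK ->.
  - apply/cvgrPdist_le => e e0.
    have [d d0 H] := derivative_onP gd zab e0.
    have z_in : \forall w \near z, w \in `]x, y[ by exact: near_in_itvoo.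
    near=> w; rewrite eqxx /=; have [_|wz] := eqVneq w z; first by rewrite subrr normr0 ltW.
    have wz0 : w - z != 0 by rewrite subr_eq0.
    rewrite distrC (_ : _ - _ = (g w - g z - g' z * (w - z)) / (w - z)); last by field.
    rewrite normrM normfV ler_pdivrMr ?normr_gt0//; apply: H.
      apply: sub; apply: subset_itv_oo_cc.
      by near: w.
    by near: w; exact: near_dist_lt.
  - by rewrite eqxx.
have cg : {within `[x, y], continuous g}.
  apply/subspace_continuousP => z zxy; apply/cvgrPdist_le => e e0.
  have zab : z \in `[a, b] by exact: sub.
  have [d d0 H] := derivative_onP gd zab ltr01.
  have k0 : 0 < 1 + `|g' z| by rewrite ltr_pwDl.
  have e1 : 0 < e / (1 + `|g' z|) by rewrite divr_gt0.
  rewrite near_withinE; near=> w => wxy.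
  have wzd : `|w - z| < d.
    by near: w; exact: near_dist_lt.
  have wze : `|w - z| < e / (1 + `|g' z|) by near: w; exact: near_dist_lt.
  have := H _ (sub _ wxy) wzd; rewrite mul1r => {}H.
  rewrite distrC (_ : g w - g z = (g w - g z - g' z * (w - z)) + g' z * (w - z)); last by ring.
  apply: le_trans (ler_normD _ _) _; rewrite normrM.
  apply: (@le_trans _ _ ((1 + `|g' z|) * `|w - z|)); first by rewrite mulrDl mul1r lerD2r.
  rewrite mulrC -ler_pdivlMr//; apply: ltW.
have [c cxy gE] := MVT xy dg cg.
rewrite distrC gE normrM [ `|x - y|]distrC ler_wpM2r//.
by apply: g'L; apply: sub; apply: subset_itv_oo_cc.
Unshelve. all: by end_near. Qed.

Lemma derivative_onB_horner (a b : R) (g g' : R -> R) (q : {poly R}) :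
  derivative_on a b g g' ->
  derivative_on a b (fun x => g x - q.[x]) (fun x => g' x - q^`().[x]).
Proof.
move=> gd x xab.
have [s sE] : exists s, q - q.[x]%:P = s * ('X - x%:P).
  by apply/factor_theorem; rewrite rootE hornerD hornerN hornerC subrr.
have q'x : q^`().[x] = s.[x].
  have := congr1 (fun p => p^`().[x]) sE.
  rewrite derivB derivC subr0 derivM derivB derivX derivC subr0 !hornerE.
  by rewrite subrr mulr0 ?add0r ?addr0 ?mulr1.
rewrite q'x.
have sx : s.[y] @[y --> within `[a, b] x^'] --> s.[x].
  apply: cvg_trans (@continuous_horner _ s x).
  by apply: cvg_app; apply: cvg_trans (cvg_within _) _; exact: nbhs_dnbhs.
apply: cvg_trans (cvgB (gd _ xab) sx).
apply: near_eq_cvg; rewrite near_withinE near_withinE; near=> y => yx _.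
have yx0 : y - x != 0 by rewrite subr_eq0.
have := congr1 (horner^~ y) sE; rewrite hornerD hornerN hornerC hornerM hornerXsubC => E.
have -> : g y - q.[y] - (g x - q.[x]) = g y - g x - s.[y] * (y - x) by rewrite -E; ring.
by rewrite mulrBl mulfK.
Unshelve. all: by end_near. Qed.

Lemma primitive_poly (r : {poly R}) :
  exists2 q : {poly R}, q^`() = r & (size q <= (size r).+1)%N.
Proof.
exists (\poly_(i < (size r).+1) (r`_i.-1 / i%:R)); last exact: size_poly.
apply/polyP => i; rewrite coef_deriv coef_poly ltnS /=.
case: ltnP => [ri|ri]; first by rewrite -[LHS]mulr_natr divfK// pnatr_eq0.
by rewrite mul0rn nth_default.
Qed.

(** If [r1] approximates $f'$ within [E] and [q] is a primitive of [r1], then $f-q$ is Lipschitz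
    with constant [E], and one more Lipschitz approximation gains $2(b-a)/k$. The degree drops by
    one at each derivative, which produces the falling factorial. *)
Lemma jackson_ffact (a b : R) (p k : nat) (f fp : R -> R) (L : R) : a < b ->
  nth_derivative_on a b p f fp -> (forall x, x \in `[a, b] -> `|fp x| <= L) ->
  (p <= k)%N ->
  exists2 r : {poly R}, (size r <= k)%N &
    forall x, x \in `[a, b] -> `|f x - r.[x]| <= (2 * (b - a)) ^+ p / (k ^_ p)%:R * L.
Proof.
move=> ab; elim: p k f => [|p IH] k f /=.
  move=> ffp fpL _; exists 0; first by rewrite size_poly0.
  by move=> x xab; rewrite horner0 subr0 expr0 ffactn0 divr1 mul1r -ffp// fpL.
move=> [f1 ff1 f1p] fpL; case: k => // k pk.
have [r1 r1k r1E] := IH _ _ f1p fpL pk.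
pose E := (2 * (b - a)) ^+ p / (k ^_ p)%:R * L; rewrite -/E in r1E.
have [q qr1 qk] := primitive_poly r1.
have lip := derivative_on_lipschitz (@derivative_onB_horner _ _ _ _ q ff1).
rewrite qr1 in lip; have {}lip := lip _ r1E.
have E0 : 0 <= E.
  by have := r1E a; rewrite in_itv/= lexx ltW//= => /(_ isT); apply: le_trans.
have [r rk rE] := jackson_lipschitz k ab E0 lip.
exists (q + r).
  rewrite (leq_trans (size_polyD _ _))// geq_max rk (leq_trans qk)//.
move=> x xab; rewrite hornerD opprD addrA; apply: le_trans (rE _ xab) _.
rewrite /E ffactnS natrM /= exprS invfM.
by rewrite le_eqVlt; apply/orP; left; apply/eqP; ring.
Qed.

(** Factor by factor, since $(p+1)(k-p)-k=p(k-p-1)\ge0$ for $p<k$. The loss depends on $p$ only and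
    becomes part of $C_p$. *)
Lemma expn_le_ffact k p : (p <= k)%N -> (k ^ p <= p`! * k ^_ p)%N.
Proof.
elim: p => // p IH pk; rewrite expnSr factS ffactnSr.
have := leq_mul (IH (ltnW pk)) (_ : k <= p.+1 * (k - p))%N.
have kp : (k <= p.+1 * (k - p))%N by nia.
by move=> /(_ kp) /leq_trans; apply; rewrite leq_eqVlt; apply/orP; left; apply/eqP; ring.
Qed.

Lemma jackson (a b : R) (p k : nat) (f fp : R -> R) (L : R) : a < b ->
  nth_derivative_on a b p f fp -> (forall x, x \in `[a, b] -> `|fp x| <= L) ->
  (p <= k)%N -> (0 < k)%N ->
  exists2 r : {poly R}, (size r <= k)%N & forall x, x \in `[a, b] ->
    `|f x - r.[x]| <= p`!%:R * (2 * (b - a)) ^+ p / k%:R ^+ p * L.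
Proof.
move=> ab ffp fpL pk k0; have [r rk rE] := jackson_ffact ab ffp fpL pk.
exists r => // x xab; apply: le_trans (rE _ xab) _.
have L0 : 0 <= L.
  by have := fpL a; rewrite in_itv/= lexx ltW//= => /(_ isT); apply: le_trans.
apply: ler_wpM2r => //; rewrite [p`!%:R * _]mulrC -mulrA ler_wpM2l//.
  by rewrite exprn_ge0//; lra.
rewrite ler_pdivlMr ?exprn_gt0 ?ltr0n// mulrC ler_pdivrMr ?ltr0n ?ffact_gt0//.
by rewrite -natrX -natrM ler_nat expn_le_ffact.
Qed.

End Jackson.

(** * The empirical method of Maurey at dyadic scales *)

Section ExpBounds.
Context {R : realType}.
Implicit Types x : R.

(** From $e^x\le1/(1-x)$ and $(1+x+2x^2)(1-x)=1+x^2(1-2x)\ge1$, with no restriction on negative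
    $x$. *)
Lemma expR_le_quad x : x <= 1 / 2 -> expR x <= 1 + x + 2 * x ^+ 2.
Proof.
move=> x1; have x0 : 0 < 1 - x by lra.
have : expR x <= (1 - x)^-1.
  by rewrite -[expR x]invrK -expRN lef_pV2 ?posrE ?expR_gt0// expR_ge1Dx.
move=> /le_trans; apply; rewrite -div1r ler_pdivrMr//.
have -> : (1 + x + 2 * x ^+ 2) * (1 - x) = 1 + x ^+ 2 * (1 - 2 * x) by ring.
by rewrite lerDl mulr_ge0 ?sqr_ge0//; lra.
Qed.

Lemma expRN_le_half x : 0 <= x <= 1 -> expR (- x) <= 1 - x / 2.
Proof.
move=> /andP[x0 x1].
have E : expR (- x) = expR (- (x / 2)) ^+ 2.
  by rewrite expr2 -expRD; congr expR; field.
have h0 : 0 < expR (- (x / 2)) by exact: expR_gt0.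
have h1 : expR (- (x / 2)) <= (1 + x / 2)^-1.
  by rewrite expRN lef_pV2 ?posrE; [exact: expR_ge1Dx|exact: expR_gt0|lra].
have h2 : expR (- (x / 2)) ^+ 2 <= (1 + x / 2)^-1 ^+ 2.
  have i0 : 0 <= (1 + x / 2)^-1 by rewrite invr_ge0; lra.
  by apply: lerXn2r => //; rewrite nnegrE ltW.
rewrite E; apply: le_trans h2 _.
rewrite exprVn -div1r ler_pdivrMr ?exprn_gt0//; last by lra.
have : 0 <= x * (1 - x) by rewrite mulr_ge0//; lra.
have : 0 <= x ^+ 2 * (1 - x) by rewrite mulr_ge0 ?sqr_ge0//; lra.
by move=> *; nra.
Qed.

Lemma expRN_le_pow2 (k : nat) : expR (- k%:R) <= 2 ^- k :> R.
Proof.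
rewrite -[k%:R]mulr1 -mulrN expRM_natl -exprVn.
apply: lerXn2r; rewrite ?nnegrE ?invr_ge0 ?ler0n ?expR_ge0//.
rewrite expRN lef_pV2 ?posrE ?expR_gt0//.
by have := expR_ge1Dx (1 : R).
Qed.

(** The averages are tested against $2\cosh x-2$ instead of $e^{|x|}$: it vanishes to second order
    at 0, so its mean is bounded by a multiple of the second moment, yet it dominates $x^2/4$ here
    and an exponential on the tails in [half_expR_le_cosh]. *)
Lemma sqr_le_cosh x : x ^+ 2 / 4 <= expR x + expR (- x) - 2.
Proof.
wlog x0 : x / 0 <= x => [hw|].
  have [/hw//|x0] := leP 0 x.
  by have := hw (- x); rewrite sqrrN opprK [expR (- x) + _]addrC; apply; lra.
have E (u : R) : expR u = expR (u / 2) ^+ 2 by rewrite expr2 -expRD; congr expR; field.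
have h1 : x / 2 <= expR (x / 2) - expR (- x / 2).
  have := expR_ge1Dx (x / 2); have : expR (- x / 2) <= 1 by rewrite expR_le1; lra.
  by move=> *; lra.
have -> : x ^+ 2 / 4 = (x / 2) ^+ 2 by field.
have -> : expR x + expR (- x) - 2 = (expR (x / 2) - expR (- x / 2)) ^+ 2.
  rewrite E (E (- x)) sqrrB -expRD.
  by rewrite (_ : x / 2 + - x / 2 = 0) ?expR0 ?mulr2n; [ring|field].
by rewrite ler_sqr ?nnegrE//; lra.
Qed.

Lemma half_expR_le_cosh (x r : R) : 4 <= expR r -> r <= `|x| ->
  expR r / 2 <= expR x + expR (- x) - 2.
Proof.
move=> r4; wlog x0 : x / 0 <= x => [hw|].
  have [/hw//|x0] := leP 0 x.
  by move=> rx; have := hw (- x); rewrite normrN opprK [expR (- x) + _]addrC; apply => //; lra.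
rewrite ger0_norm// => rx.
have : expR r <= expR x by rewrite ler_expR.
by have := expR_gt0 (- x); lra.
Qed.

End ExpBounds.

(** * Averages of random terms and their deviations *)

Section EmpiricalMethod.
Context {R : realType} {U : finType}.
Variable p : U -> R.
Hypothesis p_ge0 : forall u, 0 <= p u.
Hypothesis p_sum1 : \sum_u p u = 1.

(** The law of [t] independent draws from [p]. This auxiliary randomness stays a finite weighted
    sum, separate from the probability space of the sample. *)
Definition prodw t (w : {ffun 'I_t -> U}) : R := \prod_i p (w i).

Definition average t (w : {ffun 'I_t -> U}) (y : U -> R) : R :=
  (\sum_i y (w i)) / t%:R.

Lemma prodw_ge0 t (w : {ffun 'I_t -> U}) : 0 <= prodw w.
Proof. exact: prodr_ge0. Qed.

Lemma sum_prodwM t (g : U -> R) :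
  \sum_(w : {ffun 'I_t -> U}) prodw w * \prod_i g (w i) = (\sum_u p u * g u) ^+ t.
Proof.
under eq_bigr do rewrite -big_split/=.
rewrite -(bigA_distr_bigA (fun (i : 'I_t) u => p u * g u)).
by rewrite prodr_const card_ord.
Qed.

Lemma prodw_sum1 t : \sum_(w : {ffun 'I_t -> U}) prodw w = 1.
Proof.
have := sum_prodwM t (fun=> 1).
under [in RHS]eq_bigr do rewrite mulr1.
rewrite p_sum1 expr1n => <-; apply: eq_bigr => w _.
by rewrite big1 ?mulr1.
Qed.

Section FixedPoint.
Variables (y : U -> R) (K : R).
Hypothesis K_gt0 : 0 < K.
Hypothesis yK : forall u, `|y u| <= K.
Let f := \sum_u p u * y u.
Let V := \sum_u p u * y u ^+ 2.

Lemma mean_le : `|f| <= K.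
Proof.
apply: le_trans (ler_norm_sum _ _ _) _.
rewrite -[K]mul1r -p_sum1 mulr_suml; apply: ler_sum => u _.
by rewrite normrM ger0_norm// ler_wpM2l.
Qed.

Lemma second_moment_ge0 : 0 <= V.
Proof. by apply: sumr_ge0 => u _; rewrite mulr_ge0 ?sqr_ge0. Qed.

Lemma second_moment_le : V <= K ^+ 2.
Proof.
rewrite -[K ^+ 2]mul1r -p_sum1 mulr_suml; apply: ler_sum => u _.
rewrite ler_wpM2l// -[y u ^+ 2]real_normK ?num_real// ler_sqr ?nnegrE ?normr_ge0//.
exact: ltW.
Qed.

Lemma variance_le (c : R) : \sum_u p u * (1 + c * (y u - f) + 2 * (c * (y u - f)) ^+ 2) <=
  1 + 2 * c ^+ 2 * V.
Proof.
rewrite (_ : \sum_u _ = \sum_u p u * (1 - c * f + 2 * c ^+ 2 * f ^+ 2) +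
   (\sum_u p u * y u * (c - 4 * c ^+ 2 * f) + \sum_u p u * y u ^+ 2 * (2 * c ^+ 2))).
  rewrite -!mulr_suml p_sum1 -/f -/V.
  rewrite -subr_ge0 (_ : _ - _ = 2 * (c * f) ^+ 2); last by ring.
  by rewrite mulr_ge0 ?sqr_ge0.
by rewrite -!big_split/=; apply: eq_bigr => u _; ring.
Qed.

(** The exponential moment factors over the draws. As $|y-f|\le2K$, the condition on [c] keeps every
    exponent below $1/2$, where [expR_le_quad] applies. *)
Lemma average_mgf t (c : R) : (0 < t)%N -> `|c| * K * 4 <= t%:R ->
  \sum_(w : {ffun 'I_t -> U}) prodw w * expR (c * (average w y - f)) <=
  expR (2 * c ^+ 2 * V / t%:R).
Proof.
move=> t0 ct; have t0' : 0 < t%:R :> R by rewrite ltr0n.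
have -> : \sum_(w : {ffun 'I_t -> U}) prodw w * expR (c * (average w y - f)) =
    (\sum_u p u * expR (c / t%:R * (y u - f))) ^+ t.
  rewrite -sum_prodwM; apply: eq_bigr => w _; congr (_ * _).
  rewrite -expR_sum; congr expR; rewrite -mulr_sumr sumrB sumr_const card_ord.
  by rewrite /average -mulr_natr; field; rewrite gt_eqF.
have b0 : 0 <= 1 + 2 * (c / t%:R) ^+ 2 * V.
  apply: addr_ge0 => //; apply: mulr_ge0 second_moment_ge0.
  by apply: mulr_ge0 => //; exact: sqr_ge0.
apply: (@le_trans _ _ ((1 + 2 * (c / t%:R) ^+ 2 * V) ^+ t)).
  have le1 : \sum_u p u * expR (c / t%:R * (y u - f)) <= 1 + 2 * (c / t%:R) ^+ 2 * V.
    apply: le_trans (variance_le _); apply: ler_sum => u _; apply: ler_wpM2l => //.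
    apply: expR_le_quad; apply: le_trans (ler_norm _) _; rewrite normrM normrM.
    rewrite normfV (gtr0_norm t0').
    have : `|y u - f| <= K + K.
      by apply: le_trans (ler_normB _ _) _; apply: lerD => //; exact: mean_le.
    move=> yf; rewrite mulrAC ler_pdivrMr//.
    have : `|c| * `|y u - f| <= `|c| * (K + K) by rewrite ler_wpM2l.
    by move=> *; lra.
  apply: lerXn2r; rewrite ?nnegrE//.
  by apply: sumr_ge0 => u _; rewrite mulr_ge0 ?expR_ge0.
have -> : expR (2 * c ^+ 2 * V / t%:R) = expR (2 * (c / t%:R) ^+ 2 * V) ^+ t.
  by rewrite -expRM_natl; congr expR; rewrite -mulr_natr; field; rewrite gt_eqF.
by apply: lerXn2r; rewrite ?nnegrE ?expR_ge0 ?expR_ge1Dx.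
Qed.

(** With $\tau^2$ draws bounded by $K$ the deviation is of order $K/\tau$, the scale of $1/\lambda$.
    Each exponential moment is then at most $1+V/(4K^2)$, and subtracting 2 cancels the ones. *)
Lemma average_cosh tau lam : (0 < tau)%N -> lam = tau%:R / (4 * K) ->
  \sum_(w : {ffun 'I_(tau ^ 2) -> U}) prodw w *
    (expR (lam * (average w y - f)) + expR (- (lam * (average w y - f))) - 2) <=
  V / (2 * K ^+ 2).
Proof.
move=> tau0 lamE.
have tau0' : 0 < tau%:R :> R by rewrite ltr0n.
have lam0 : 0 < lam by rewrite lamE divr_gt0// mulr_gt0.
have t0 : (0 < tau ^ 2)%N by rewrite expn_gt0 tau0.
have lamt (c : R) : `|c| = lam -> `|c| * K * 4 <= (tau ^ 2)%N%:R.
  move=> ->; rewrite (_ : lam * K * 4 = tau%:R); last by rewrite lamE; field; rewrite gt_eqF.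
  by rewrite ler_nat -{1}[tau]expn1 leq_pexp2l.
have V0 := second_moment_ge0; have VK := second_moment_le.
have K2 : 0 < K ^+ 2 by rewrite exprn_gt0.
have H (c : R) : `|c| = lam ->
    \sum_(w : {ffun 'I_(tau ^ 2) -> U}) prodw w * expR (c * (average w y - f)) <=
    1 + V / (4 * K ^+ 2).
  move=> cl; have M := average_mgf t0 (lamt c cl); apply: le_trans M _.
  have -> : 2 * c ^+ 2 * V / (tau ^ 2)%N%:R = V / (8 * K ^+ 2).
    rewrite -[c ^+ 2]real_normK ?num_real// cl lamE natrX; field.
    by rewrite !gt_eqF.
  set v := V / (8 * K ^+ 2).
  have v8 : v <= 1 / 8 by rewrite /v ler_pdivrMr ?mulr_gt0//; lra.
  have v0 : 0 <= v by rewrite /v divr_ge0// mulr_ge0// ltW.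
  have -> : V / (4 * K ^+ 2) = 2 * v by rewrite /v; field; rewrite gt_eqF.
  apply: le_trans (expR_le_quad _) _; first by lra.
  by nra.
under eq_bigr do rewrite mulrBr mulrDr -[- (lam * _)]mulNr.
rewrite sumrB big_split/= -mulr_suml prodw_sum1.
have h1 := H lam (gtr0_norm lam0).
have h2 := H (- lam); rewrite normrN in h2; have {}h2 := h2 (gtr0_norm lam0).
have -> : V / (2 * K ^+ 2) = V / (4 * K ^+ 2) + V / (4 * K ^+ 2) by field; rewrite gt_eqF.
by lra.
Qed.

Lemma average_variance tau : (0 < tau)%N ->
  \sum_(w : {ffun 'I_(tau ^ 2) -> U}) prodw w * (average w y - f) ^+ 2 <=
  32 * V / tau%:R ^+ 2.
Proof.
move=> tau0; have tau0' : 0 < tau%:R :> R by rewrite ltr0n.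
have K2 : 0 < K ^+ 2 by rewrite exprn_gt0.
have := average_cosh tau0 erefl; set lam := _ / _; set S := \sum_w _ => SV.
apply: (@le_trans _ _ (64 * K ^+ 2 / tau%:R ^+ 2 * S)).
  rewrite mulr_sumr; apply: ler_sum => w _; rewrite [leRHS]mulrCA ler_wpM2l ?prodw_ge0//.
  have := sqr_le_cosh (lam * (average w y - f)).
  set Z := average w y - f; set C := _ - 2 => ZC.
  rewrite mulrAC ler_pdivlMr ?exprn_gt0//.
  have E : (lam * Z) ^+ 2 = Z ^+ 2 * tau%:R ^+ 2 / (16 * K ^+ 2).
    by rewrite /lam; field; rewrite gt_eqF.
  rewrite E in ZC; move: ZC; rewrite ler_pdivrMr// ler_pdivrMr ?mulr_gt0//.
  by move=> *; lra.
apply: (@le_trans _ _ (64 * K ^+ 2 / tau%:R ^+ 2 * (V / (2 * K ^+ 2)))).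
  apply: ler_wpM2l => //; apply: divr_ge0; last exact: sqr_ge0.
  by apply: mulr_ge0 => //; exact: sqr_ge0.
by rewrite le_eqVlt; apply/orP; left; apply/eqP; field; rewrite !gt_eqF.
Qed.

Lemma average_tail tau (r : R) : (0 < tau)%N -> 4 <= expR (tau%:R / (4 * K) * r) ->
  \sum_(w : {ffun 'I_(tau ^ 2) -> U}) prodw w * (r <= `|average w y - f|)%R%:R <=
  expR (- (tau%:R / (4 * K) * r)) * V / K ^+ 2.
Proof.
move=> tau0 r4; have tau0' : 0 < tau%:R :> R by rewrite ltr0n.
have K2 : 0 < K ^+ 2 by rewrite exprn_gt0.
have := average_cosh tau0 erefl; move: r4; set lam := _ / _; set S := \sum_w _ => r4 SV.
have lam0 : 0 < lam by rewrite divr_gt0// mulr_gt0.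
apply: (@le_trans _ _ (2 * expR (- (lam * r)) * S)).
  rewrite mulr_sumr; apply: ler_sum => w _; rewrite [leRHS]mulrCA ler_wpM2l ?prodw_ge0//.
  set C := _ - 2.
  have C0 : 0 <= C by apply: le_trans (sqr_le_cosh _); rewrite divr_ge0 ?sqr_ge0.
  case: (leP r) => [rZ|_]; last by rewrite !mulr_ge0 ?expR_ge0.
  have := half_expR_le_cosh r4; move=> /(_ (lam * (average w y - f))).
  rewrite normrM gtr0_norm// ler_pM2l// => /(_ rZ); rewrite -/C expRN => h.
  have e0 := expR_gt0 (lam * r).
  rewrite (_ : 2 * _ * C = C / (expR (lam * r) / 2)); last by field; rewrite gt_eqF.
  by rewrite ler_pdivlMr ?divr_gt0// mul1r.
apply: (@le_trans _ _ (2 * expR (- (lam * r)) * (V / (2 * K ^+ 2)))).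
  by rewrite ler_wpM2l// mulr_ge0 ?expR_ge0.
by rewrite le_eqVlt; apply/orP; left; apply/eqP; field; rewrite gt_eqF.
Qed.

End FixedPoint.

Definition level (K : R) i : R := K / 2 ^+ i.

(* Above the last level [L] a function is only recorded through its dyadic
   size; at level [L] it is truncated. *)
Definition theta (K : R) L i (u : R) : R :=
  if (i < L)%N then (if 3 / 8 * level K i <= `|u| then level K i ^+ 2 else 0)
  else Num.min (u ^+ 2) (level K i ^+ 2).

(* The standard deviation of an average of [samples k i ^ 2] terms is smaller
   than [level K i] by a factor of order [k], which makes the probability of
   misjudging a level exponentially small in [k]. *)
Definition samples k i : nat := (32 * k * 2 ^ i)%N.

Definition level_mean (K : R) L k (y : U -> R) i : R :=
  \sum_(w : {ffun 'I_(samples k i ^ 2) -> U}) prodw w * theta K L i (average w y).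

Definition sampling_error k L : R := 4 / 3 * 2 ^- k + (16 * k%:R ^+ 2 * 4 ^+ L)^-1.

Lemma level0 (K : R) : level K 0 = K.
Proof. by rewrite /level expr0 divr1. Qed.

Lemma sum_levels_le (K F : R) n : 0 < K ->
  \sum_(i < n) (if level K i <= F then level K i ^+ 2 else 0) <= 4 / 3 * F ^+ 2.
Proof.
move=> K0.
have geo : forall n, \sum_(i < n) level K i ^+ 2 <= 4 / 3 * K ^+ 2.
  move=> m; suff -> : \sum_(i < m) level K i ^+ 2 = 4 / 3 * K ^+ 2 * (1 - 4 ^- m).
    apply: ler_piMr; first by apply: mulr_ge0 => //; exact: sqr_ge0.
    by rewrite gerBl invr_ge0 exprn_ge0.
  elim: m => [|m IH]; first by rewrite big_ord0 expr0 invr1 subrr mulr0.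
  rewrite big_ord_recr /= IH /level expr_div_n -exprM mulnC exprM.
  rewrite (_ : 2 ^+ 2 = 4); last by ring.
  by rewrite [4 ^+ m.+1]exprS; field; rewrite expf_neq0.
elim: n K K0 geo => [|n IH] K K0 geo; first by rewrite big_ord0 mulr_ge0 ?sqr_ge0.
rewrite big_ord_recl level0; case: ifPn => KF.
  apply: (@le_trans _ _ (\sum_(i < n.+1) level K i ^+ 2)).
    rewrite big_ord_recl level0 lerD2l; apply: ler_sum => i _.
    by case: ifP => // _; exact: sqr_ge0.
  apply: le_trans (geo _) _; rewrite ler_pM2l//.
  by apply: lerXn2r; rewrite ?nnegrE ?(ltW K0)//; apply: le_trans KF; exact: ltW.
rewrite add0r.
have lE i : level K (lift ord0 i) = level (K / 2) i.
  by rewrite /level lift0 exprS invfM mulrA.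
have lE' i : level K i.+1 = level (K / 2) i.
  by rewrite /level exprS invfM mulrA.
under eq_bigr do rewrite lE.
apply: IH => [|m]; first by rewrite divr_gt0.
have := geo m.+1; rewrite big_ord_recl level0.
under eq_bigr do rewrite lE.
have -> : (K / 2) ^+ 2 = K ^+ 2 / 4 by field.
by move=> *; lra.
Qed.

(** * Comparison of the dyadic levels with the squared mean *)

Section Levels.
Variables (y : U -> R) (K : R) (k L : nat).
Hypothesis K_gt0 : 0 < K.
Hypothesis yK : forall u, `|y u| <= K.
Hypothesis k_ge2 : (2 <= k)%N.
Let f := \sum_u p u * y u.
Let V := \sum_u p u * y u ^+ 2.

Lemma level_gt0 i : 0 < level K i.
Proof. by rewrite divr_gt0// exprn_gt0. Qed.

Lemma samples_gt0 i : (0 < samples k i)%N.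
Proof. by rewrite !muln_gt0 expn_gt0; lia. Qed.

Lemma theta_ge0 i u : 0 <= theta K L i u.
Proof.
rewrite /theta; case: ifP => _; first by case: ifP => // _; exact: sqr_ge0.
by rewrite le_min !sqr_ge0.
Qed.

Lemma theta_le i u : theta K L i u <= level K i ^+ 2.
Proof.
rewrite /theta; case: ifP => _; last by rewrite ge_min lexx orbT.
by case: ifP => // _; exact: sqr_ge0.
Qed.

Lemma level_mean_ge0 i : 0 <= level_mean K L k y i.
Proof. by apply: sumr_ge0 => w _; rewrite mulr_ge0 ?prodw_ge0 ?theta_ge0. Qed.

Lemma level_tail i :
  \sum_(w : {ffun 'I_(samples k i ^ 2) -> U})
    prodw w * (level K i / 8 <= `|average w y - f|)%R%:R <=
  2 ^- k * V / K ^+ 2.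
Proof.
(* The 32 in [samples] is $4\cdot8$: the 4 from [average_tail], the 8 from the tolerated deviation,
   so that the exponent is exactly $k$. *)
have E : (samples k i)%:R / (4 * K) * (level K i / 8) = k%:R.
  by rewrite /samples /level !natrM natrX; field; rewrite expf_neq0//= gt_eqF.
have := average_tail K_gt0 yK (samples_gt0 i); move=> /(_ (level K i / 8)).
rewrite E; have k4 : 4 <= expR k%:R :> R.
  have -> : 4 = 2 ^+ 2 :> R by ring.
  apply: (@le_trans _ _ (expR 1 ^+ 2)).
    by apply: lerXn2r; rewrite ?nnegrE ?expR_ge0//; have := expR_ge1Dx (1 : R).
  by rewrite -expRM_natl mulr1 ler_expR ler_nat.
move=> /(_ k4) /le_trans; apply; rewrite ler_pM2r ?invr_gt0 ?exprn_gt0//.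
by rewrite ler_wpM2r ?expRN_le_pow2// second_moment_ge0.
Qed.

Lemma level_tail_le i :
  level K i ^+ 2 * (2 ^- k * V / K ^+ 2) <= 2 ^- k / 4 ^+ i * V.
Proof.
rewrite /level expr_div_n -exprM mulnC exprM (_ : 2 ^+ 2 = 4); last by ring.
rewrite le_eqVlt; apply/orP; left; apply/eqP; field.
by rewrite !expf_neq0//= gt_eqF.
Qed.

Lemma last_variance : (k != 0)%N ->
  \sum_(w : {ffun 'I_(samples k L ^ 2) -> U}) prodw w * (average w y - f) ^+ 2 <=
  (32 * k%:R ^+ 2 * 4 ^+ L)^-1 * V.
Proof.
move=> k0; have := average_variance K_gt0 yK (samples_gt0 L).
move=> /le_trans; apply; rewrite le_eqVlt; apply/orP; left; apply/eqP.
rewrite /samples !natrM natrX !exprMn -exprM mulnC exprM (_ : 2 ^+ 2 = 4); last by ring.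
by rewrite -/V; field; rewrite ?expf_neq0 ?pnatr_eq0.
Qed.

(** The threshold $3/8$ in [theta] lies midway between $1/4$ and $1/2$. If a level is counted
    although $|f|$ is below a quarter of it, the average is off by an eighth, an event covered by
    [level_tail]; the levels up to $4|f|$ sum to at most $\frac43\cdot16f^2$. The last level adds
    $2f^2$ through $g^2\le2f^2+2(g-f)^2$, and the total is below $24f^2$. *)
Lemma sum_levels_upper :
  \sum_(i < L.+1) level_mean K L k y i <= 24 * f ^+ 2 + sampling_error k L * V.
Proof.
have V0 : 0 <= V by exact: second_moment_ge0.
have k0 : (k != 0)%N by lia.
rewrite big_ord_recr /=.
have last : level_mean K L k y L <= 2 * f ^+ 2 + (16 * k%:R ^+ 2 * 4 ^+ L)^-1 * V.
  apply: (@le_trans _ _ (\sum_(w : {ffun 'I_(samples k L ^ 2) -> U})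
     (prodw w * (2 * f ^+ 2) + 2 * (prodw w * (average w y - f) ^+ 2)))).
    apply: ler_sum => w _; rewrite [2 * (prodw w * _)]mulrCA -mulrDr ler_wpM2l ?prodw_ge0//.
    rewrite /theta ltnn; apply: (@le_trans _ _ (average w y ^+ 2)).
      by rewrite ge_min lexx.
    have := sqr_ge0 (average w y - 2 * f); set g := average w y.
    by move=> *; nra.
  rewrite big_split/= -mulr_suml prodw_sum1 mul1r lerD2l -mulr_sumr.
  apply: (@le_trans _ _ (2 * ((32 * k%:R ^+ 2 * 4 ^+ L)^-1 * V))).
    by rewrite ler_pM2l// last_variance.
  rewrite le_eqVlt; apply/orP; left; apply/eqP; field.
  by rewrite ?expf_neq0 ?pnatr_eq0.
have step (i : 'I_L) : level_mean K L k y i <=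
    (if level K i <= 4 * `|f| then level K i ^+ 2 else 0) + 2 ^- k / 4 ^+ i * V.
  apply: (@le_trans _ _ (\sum_(w : {ffun 'I_(samples k i ^ 2) -> U})
     (prodw w * (if level K i <= 4 * `|f| then level K i ^+ 2 else 0) +
      level K i ^+ 2 * (prodw w * (level K i / 8 <= `|average w y - f|)%R%:R)))).
    apply: ler_sum => w _; rewrite [level K i ^+ 2 * _]mulrCA -mulrDr ler_wpM2l ?prodw_ge0//.
    rewrite /theta ltn_ord; set g := average w y.
    have b2 : 0 <= level K i ^+ 2 by exact: sqr_ge0.
    case: ifP => [bg|_]; last first.
      by apply: addr_ge0; [case: ifP|rewrite mulr_ge0].
    case: (leP (level K i)) => [_|bf]; first by rewrite lerDl mulr_ge0.
    case: (leP (level K i / 8)) => [_|gf]; first by rewrite add0r mulr1.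
    exfalso; have : `|g| <= `|g - f| + `|f|.
      by rewrite -{1}[g](subrK f) ler_normD.
    by move=> *; lra.
  rewrite big_split/= -mulr_suml prodw_sum1 mul1r lerD2l -mulr_sumr.
  apply: le_trans (level_tail_le i); rewrite ler_pM2l ?exprn_gt0 ?level_gt0//.
  exact: level_tail.
apply: le_trans (lerD (ler_sum _ (fun i _ => step i)) last) _.
rewrite big_split/= -mulr_suml.
have s1 : \sum_(i < L) 2 ^- k / 4 ^+ i <= 4 / 3 * 2 ^- k :> R.
  have : 0 < 2 ^- k :> R by rewrite invr_gt0 exprn_gt0.
  rewrite -mulr_sumr [4 / 3 * _]mulrC => k1; rewrite ler_pM2l//.
  have geo m : \sum_(i < m) (4 ^+ i)^-1 = 4 / 3 * (1 - 4 ^- m) :> R.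
    elim: m => [|m IH]; first by rewrite big_ord0 expr0 invr1 subrr mulr0.
    by rewrite big_ord_recr /= IH exprS; field; rewrite expf_neq0.
  by rewrite geo ler_piMr// gerBl invr_ge0 exprn_ge0.
have s2 := sum_levels_le (4 * `|f|) L K_gt0.
have f2 : (4 * `|f|) ^+ 2 = 16 * f ^+ 2 by rewrite exprMn real_normK ?num_real//; ring.
rewrite f2 in s2.
have s3 : (\sum_(i < L) 2 ^- k / 4 ^+ i) * V <= 4 / 3 * 2 ^- k * V by rewrite ler_wpM2r.
have f0 := sqr_ge0 f.
rewrite /sampling_error [(_ + _) * V]mulrDl. lra.
Qed.

(** A single level suffices. If $|f|$ exceeds the last level, take the level $\lambda$ with
    $\lambda/2<|f|\le\lambda$: an average that fails to count there is off by at least $\lambda/8$.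
    Otherwise the truncated last level sees $f$, up to the variance of its average. *)
Lemma sum_levels_lower :
  f ^+ 2 <= 2 * (\sum_(i < L.+1) level_mean K L k y i) + sampling_error k L * V.
Proof.
have V0 : 0 <= V by exact: second_moment_ge0.
have k0 : (k != 0)%N by lia.
have fK : `|f| <= level K 0 by rewrite level0 mean_le.
have sub i : (i < L.+1)%N -> level_mean K L k y i <= \sum_(j < L.+1) level_mean K L k y j.
  move=> iL; rewrite (bigD1 (Ordinal iL))//= lerDl sumr_ge0// => j _.
  exact: level_mean_ge0.
have e1 : 0 <= (16 * k%:R ^+ 2 * 4 ^+ L)^-1 * V.
  by rewrite mulr_ge0// invr_ge0 !mulr_ge0 ?sqr_ge0// exprn_ge0.
have e2 : 0 <= 4 / 3 * 2 ^- k * V.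
  by rewrite !mulr_ge0// invr_ge0 exprn_ge0.
have [fL|fL] := leP `|f| (level K L).
  apply: (@le_trans _ _ (2 * level_mean K L k y L + (16 * k%:R ^+ 2 * 4 ^+ L)^-1 * V)).
    apply: (@le_trans _ _ (\sum_(w : {ffun 'I_(samples k L ^ 2) -> U})
       (2 * (prodw w * theta K L L (average w y)) +
        2 * (prodw w * (average w y - f) ^+ 2)))).
      have -> : f ^+ 2 = \sum_(w : {ffun 'I_(samples k L ^ 2) -> U}) prodw w * f ^+ 2.
        by rewrite -mulr_suml prodw_sum1 mul1r.
      apply: ler_sum => w _; rewrite -[leRHS]mulrDr -mulrDr [leRHS]mulrCA.
      rewrite ler_wpM2l ?prodw_ge0//.
      rewrite /theta ltnn; set g := average w y.
      have fL2 : f ^+ 2 <= level K L ^+ 2.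
        by rewrite -[f ^+ 2]real_normK ?num_real//; apply: lerXn2r; rewrite ?nnegrE// ltW// level_gt0.
      have := sqr_ge0 (g - f); have := sqr_ge0 g; have := sqr_ge0 f.
      have := sqr_ge0 (2 * g - f).
      rewrite minEle; case: ifP => _ p1 p2 p3 p4; last by lra.
      by rewrite -subr_ge0 (_ : _ - _ = (2 * g - f) ^+ 2); last by ring.
    rewrite big_split/= -!mulr_sumr lerD2l.
    apply: (@le_trans _ _ (2 * ((32 * k%:R ^+ 2 * 4 ^+ L)^-1 * V))).
      by rewrite ler_pM2l// last_variance.
    rewrite le_eqVlt; apply/orP; left; apply/eqP; field.
    by rewrite ?expf_neq0 ?pnatr_eq0.
  have := sub L (ltnSn L); rewrite /sampling_error [(_ + _) * V]mulrDl; lra.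
have [i iL fi] : exists2 i, (i < L)%N & level K i.+1 < `|f| <= level K i.
  elim: L fL => [|n IH] fn; first by move: fn; rewrite ltNge fK.
  have [fn'|/IH[i i_n fi]] := leP `|f| (level K n); first by exists n; rewrite ?fn.
  by exists i => //; apply: ltnW.
have lS : level K i.+1 = level K i / 2 by rewrite /level exprS invfM; ring.
move: fi => /andP[]; rewrite lS => f1 f2.
apply: (@le_trans _ _ (level_mean K L k y i + 2 ^- k / 4 ^+ i * V)).
  apply: (@le_trans _ _ (\sum_(w : {ffun 'I_(samples k i ^ 2) -> U})
       (prodw w * theta K L i (average w y) +
      level K i ^+ 2 * (prodw w * (level K i / 8 <= `|average w y - f|)%R%:R)))).
    have -> : f ^+ 2 = \sum_(w : {ffun 'I_(samples k i ^ 2) -> U}) prodw w * f ^+ 2.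
      by rewrite -mulr_suml prodw_sum1 mul1r.
    apply: ler_sum => w _; rewrite [level K i ^+ 2 * _]mulrCA.
    rewrite -mulrDr ler_wpM2l ?prodw_ge0//.
    have fL2 : f ^+ 2 <= level K i ^+ 2.
      by rewrite -[f ^+ 2]real_normK ?num_real//; apply: lerXn2r; rewrite ?nnegrE// ltW// level_gt0.
    apply: le_trans fL2 _.
    rewrite /theta iL; set g := average w y.
    have b2 : 0 <= level K i ^+ 2 by exact: sqr_ge0.
    case: (leP (3 / 8 * level K i)) => [_|bg]; first by rewrite lerDl mulr_ge0.
    case: (leP (level K i / 8)) => [_|gf]; first by rewrite add0r mulr1.
    exfalso; have : `|f| <= `|g - f| + `|g|.
      by rewrite distrC -{1}[f](subrK g) ler_normD.
    by have := level_gt0 i; move=> *; lra.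
  rewrite big_split/= -mulr_sumr lerD2l.
  apply: le_trans (level_tail_le i); rewrite ler_pM2l ?exprn_gt0 ?level_gt0//.
  exact: level_tail.
have : 2 ^- k / 4 ^+ i * V <= 4 / 3 * 2 ^- k * V.
  rewrite ler_wpM2r// [4 / 3 * _]mulrC ler_wpM2l ?invr_ge0 ?exprn_ge0//.
  apply: (@le_trans _ _ 1); last by lra.
  by rewrite invf_le1 ?exprn_gt0// exprn_ege1// ler1n.
have := sub i (ltnW iL); have := level_mean_ge0 i.
by rewrite /sampling_error [(_ + _) * V]mulrDl; lra.
Qed.

End Levels.
End EmpiricalMethod.

(** * Product expectations and Chernoff bounds *)

Section Independence.
Context {R : realType} {d : measure_display} {T : measurableType d}.
Import HBNNSimple.
Variable P : probability T R.

Lemma integral_sum_indic (I : finType) (c : I -> R) (A : I -> set T) :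
  (forall i, 0 <= c i) -> (forall i, measurable (A i)) ->
  (\int[P]_w (\sum_i c i * \1_(A i) w)%:E = (\sum_i c i * fine (P (A i)))%:E)%E.
Proof.
move=> c0 mA; under eq_integral do rewrite -sumEFin.
rewrite ge0_integral_sum//; last first.
- by move=> i w _; rewrite lee_fin mulr_ge0// indicE; case: (_ \in _).
- move=> i; apply/measurable_EFinP; apply: measurable_funM => //.
rewrite -sumEFin; apply: eq_bigr => i _.
under eq_integral do rewrite EFinM.
rewrite ge0_integralZl_EFin//; last first.
  by apply/measurable_EFinP; exact: measurable_indic.
by rewrite integral_indic// setIT EFinM fineK// fin_num_measure.
Qed.

Variables (m : nat) (X : 'I_m -> {RV P >-> R}).
Hypothesis indep : mutually_independent X.

Lemma indep_all (B : 'I_m -> set R) : (forall j, measurable (B j)) ->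
  fine (P (\bigcap_(j in [set: 'I_m]) (X j @^-1` B j))) =
  \prod_j fine (P (X j @^-1` B j)).
Proof.
move=> mB; have := indep [set: 'I_m]%SET mB.
rewrite (_ : [set` [set: 'I_m]%SET] = [set: 'I_m]); last first.
  by apply/seteqP; split => // j _ /=; rewrite finset.in_setT.
move=> ->; rewrite -[RHS]/(fine (_)%:E) -prodEFin; congr fine.
apply: eq_big => [j|j _]; first by rewrite finset.in_setT.
rewrite fineK// fin_num_measure//.
by rewrite -[X in measurable X]setTI; exact: measurable_funP.
Qed.

Lemma indep_prod_simple (g : {nnsfun R >-> R}) :
  (\int[P]_w (\prod_j g (X j w))%:E = \prod_j \int[P]_w (g (X j w))%:E)%E.
Proof.
pose s := fset_set (range g); pose c (i : 'I_#|` s|) := s`_i.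
pose B (i : 'I_#|` s|) : set R := g @^-1` [set c i].
have gE x : g x = \sum_i c i * \1_(B i) x by rewrite fimfunEord.
have c0 i : 0 <= c i.
  have : c i \in s by apply: mem_nth.
  by move=> h; have := h; rewrite /s in_fset_set// => /set_mem[x _ <-]; exact: fun_ge0.
have mB i : measurable (B i) by exact: measurable_funPTI.
have mXB j i : measurable (X j @^-1` B i).
  by rewrite -[X in measurable X]setTI; exact: measurable_funP.
have gX j : (\int[P]_w (g (X j w))%:E = (\sum_i c i * fine (P (X j @^-1` B i)))%:E)%E.
  rewrite -(integral_sum_indic c0 (mXB j)); apply: eq_integral => w _.
  by rewrite gE.
under [RHS]eq_bigr do rewrite gX.
rewrite prodEFin bigA_distr_bigA/=.
have E w : \prod_j g (X j w) = \sum_(f : {ffun 'I_m -> 'I_#|` s|})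
    (\prod_j c (f j)) * \1_(\bigcap_(j in [set: 'I_m]) (X j @^-1` B (f j))) w.
  under eq_bigr do rewrite gE.
  rewrite bigA_distr_bigA/=; apply: eq_bigr => f _; rewrite big_split/=; congr (_ * _).
  rewrite indicE; case: (boolP (w \in _)) => [|].
    by move=> /set_mem h; rewrite big1// => j _; rewrite indicE mem_set//; exact: h.
  move=> wB; have [j jB] : exists j, ~ B (f j) (X j w).
    by apply/not_existsP => h; move/negP: wB; apply; apply: mem_set => j _; apply: contrapT; exact: h.
  by rewrite (bigD1 j)//= indicE memNset// mul0r.
under eq_integral do rewrite E.
rewrite integral_sum_indic.
- congr EFin; apply: eq_bigr => f _; rewrite big_split/=; congr (_ * _).
  exact: indep_all.
- by move=> f; exact: prodr_ge0.
- by move=> f; apply: fin_bigcap_measurable.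
Qed.

Lemma lee_prod (I : finType) (x y : I -> \bar R) :
  (forall i, 0 <= x i)%E -> (forall i, x i <= y i)%E ->
  (\prod_i x i <= \prod_i y i)%E.
Proof.
move=> x0 xy; suff : (0 <= \prod_i x i /\ \prod_i x i <= \prod_i y i)%E by case.
apply: (big_ind2 (fun u v : \bar R => 0 <= u /\ u <= v)%E) => //.
by move=> u1 v1 u2 v2 [u10 uv1] [u20 uv2]; rewrite mule_ge0// lee_pmul.
Qed.

Lemma measurable_RV_comp j (h : R -> R) : measurable_fun setT h ->
  measurable_fun setT (fun w => h (X j w)).
Proof. by move=> mh; apply: measurableT_comp => //; exact: measurable_funP. Qed.

(** One inequality is enough for Chernoff's bound and avoids limits of products of extended reals:
    monotone convergence acts on the left, and on the right each simple function is simply bounded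
    by [h]. *)
Lemma indep_prod_le (h : R -> R) : measurable_fun setT h -> (forall x, 0 <= h x) ->
  (\int[P]_w (\prod_j h (X j w))%:E <= \prod_j \int[P]_w (h (X j w))%:E)%E.
Proof.
move=> mh h0.
have mEh : measurable_fun setT (EFin \o h) by apply/measurable_EFinP.
pose g := nnsfun_approx measurableT mEh.
have gh x : g n x @[n --> \oo] --> h x.
  have : (EFin \o g^~ x) @ \oo --> (h x)%:E.
    by apply: (cvg_nnsfun_approx measurableT mEh) => // y _; rewrite lee_fin.
  by move/fine_cvg.
have gnd x : nondecreasing_seq (g ^~ x).
  by move=> i j ij; exact/lefP/nd_nnsfun_approx.
have gle n x : g n x <= h x.
  rewrite -(cvg_lim _ (gh x))//; apply: nondecreasing_cvgn_le; first exact: gnd.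
  by apply/cvg_ex; exists (h x).
have mg n : measurable_fun setT (fun w => (\prod_j g n (X j w))%:E).
  by apply/measurable_EFinP; apply: measurable_prod => j _; exact: measurable_RV_comp.
have cv : (\int[P]_w (\prod_j g n (X j w))%:E)%E @[n --> \oo] -->
    (\int[P]_w (limn (fun n => (\prod_j g n (X j w))%:E)))%E.
  apply: cvg_monotone_convergence => //.
  - by move=> n w _; rewrite lee_fin prodr_ge0.
  - by move=> w _ a b ab; rewrite lee_fin ler_prod// => j _; rewrite fun_ge0 gnd.
have hlim w : limn (fun n => (\prod_j g n (X j w))%:E) = (\prod_j h (X j w))%:E.
  apply/cvg_lim => //; apply: cvg_EFin; first exact: nearW.
  rewrite [X in X @ _ --> _](_ : _ = fun n => \prod_j g n (X j w)); last by [].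
  by apply: cvg_big => [|j _]; [exact: mul_continuous|exact: gh].
under eq_integral do rewrite -hlim.
rewrite -(cvg_lim _ cv)//; apply: lime_le; first by apply/cvg_ex; eexists; exact: cv.
apply: nearW => n; rewrite indep_prod_simple; apply: lee_prod => j.
- by apply: integral_ge0 => w _; rewrite lee_fin.
- apply: ge0_le_integral => //.
  + by move=> w _; rewrite lee_fin.
  + by apply/measurable_EFinP; exact: (measurable_RV_comp j (measurable_funP (g n))).
  + by apply/measurable_EFinP; exact: measurable_RV_comp.
  + by move=> w _; rewrite lee_fin.
Qed.

Lemma chernoff (g : R -> R) (beta c : R) : measurable_fun setT g ->
  (forall j, (\int[P]_w (expR (g (X j w)))%:E <= (expR beta)%:E)%E) ->
  (P [set w | (c <= \sum_j g (X j w))%R] <= (expR (m%:R * beta - c))%:E)%E.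
Proof.
move=> mg gb.
have msum : measurable_fun setT (fun w => \sum_j g (X j w)).
  by apply: measurable_sum => j; exact: measurable_RV_comp.
set A := [set w | _].
have mA : measurable A.
  rewrite (_ : A = (fun w => \sum_j g (X j w)) @^-1` `[c, +oo[); last first.
    by apply/seteqP; split => w /=; rewrite in_itv /= andbT.
  by rewrite -[X in measurable X]setTI; exact: msum.
have mexp : measurable_fun setT (fun x => expR (g x)).
  by apply: measurableT_comp => //; exact: measurable_expR.
have mprod : measurable_fun setT (fun w => (\prod_j expR (g (X j w)))%:E).
  apply/measurable_EFinP; apply: measurable_prod => j _.
  exact: (measurable_RV_comp j mexp).
apply: (@le_trans _ _ (\int[P]_w ((expR (- c))%:E * (\prod_j expR (g (X j w)))%:E))%E).
  rewrite -(setIT A) -integral_indic//; apply: ge0_le_integral => //.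
  - by apply/measurable_EFinP; exact: measurable_indic.
  - by apply: emeasurable_funM => //; exact: measurable_cst.
  - move=> w _; rewrite -EFinM lee_fin -expR_sum -expRD indicE.
    case: (boolP (w \in A)) => [/set_mem wA|_]; last exact: expR_ge0.
    by rewrite -expR0 ler_expR addrC subr_ge0.
rewrite ge0_integralZl_EFin ?expR_ge0//; last first.
  by move=> w _; rewrite lee_fin prodr_ge0// => j _; exact: expR_ge0.
rewrite addrC expRD EFinM; apply: lee_wpmul2l; first by rewrite lee_fin expR_ge0.
apply: le_trans (indep_prod_le mexp (fun=> expR_ge0 _)) _.
have -> : expR (m%:R * beta) = \prod_(j < m) expR beta.
  by rewrite prodr_const card_ord -expRM_natl.
rewrite -prodEFin; apply: lee_prod => j; last exact: gb.
by apply: integral_ge0 => w _; rewrite lee_fin expR_ge0.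
Qed.

Section Identical.
Variable mu : probability R R.
Hypothesis Xmu : forall j (B : set R), measurable B -> distribution P (X j) B = mu B.

Lemma ge0_integral_RV j (h : R -> \bar R) : measurable_fun setT h ->
  (forall x, 0 <= h x)%E -> (\int[P]_w h (X j w) = \int[mu]_x h x)%E.
Proof.
move=> mh h0; rewrite -(ge0_integral_distribution (X j) mh h0).
by apply: eq_measure_integral => B mB _; exact: Xmu.
Qed.

End Identical.
End Independence.

(** * Means of bounded measurable functions *)

Section BoundedMeasurable.
Context {R : realType} (mu : probability R R).

Definition bmeas (h : R -> R) : Prop :=
  measurable_fun setT h /\ exists M, forall x, `|h x| <= M.

Lemma bmeas_integrable h : bmeas h -> mu.-integrable setT (EFin \o h).
Proof.
move=> [mh [M hM]]; apply: measurable_bounded_integrable => //.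
  by apply: le_lt_trans (ltry 1); exact: probability_le1.
exists M; split; first exact: num_real.
by move=> x Mx y _ /=; apply: le_trans (hM y) (ltW Mx).
Qed.

Lemma bmeas_cst c : bmeas (fun=> c).
Proof. by split; [exact: measurable_cst|exists `|c|]. Qed.

Lemma bmeasD g h : bmeas g -> bmeas h -> bmeas (fun x => g x + h x).
Proof.
move=> [mg [M gM]] [mh [L hL]]; split; first exact: measurable_funD.
by exists (M + L) => x; apply: le_trans (ler_normD _ _) _; apply: lerD.
Qed.

Lemma bmeasM g h : bmeas g -> bmeas h -> bmeas (fun x => g x * h x).
Proof.
move=> [mg [M gM]] [mh [L hL]]; split; first exact: measurable_funM.
by exists (M * L) => x; rewrite normrM ler_pM.
Qed.

Lemma bmeas_expR g : bmeas g -> bmeas (fun x => expR (g x)).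
Proof.
move=> [mg [M gM]]; split.
  by apply: measurableT_comp => //; exact: measurable_expR.
exists (expR M) => x; rewrite ger0_norm ?expR_ge0// ler_expR.
exact: le_trans (ler_norm _) (gM x).
Qed.

Lemma bmeas_sum (I : Type) (r : seq I) (h : I -> R -> R) :
  (forall i, bmeas (h i)) -> bmeas (fun x => \sum_(i <- r) h i x).
Proof.
move=> bh; elim: r => [|i r IH].
  by under eq_fun do rewrite big_nil; exact: bmeas_cst.
by under eq_fun do rewrite big_cons; exact: bmeasD.
Qed.

Lemma mean_sum (I : Type) (r : seq I) (h : I -> R -> R) : (forall i, bmeas (h i)) ->
  \int[mu]_x (\sum_(i <- r) h i x) = \sum_(i <- r) \int[mu]_x h i x.
Proof.
move=> bh; elim: r => [|i r IH].
  under eq_Rintegral do rewrite big_nil.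
  by rewrite big_nil Rintegral_cst// mul0r.
under eq_Rintegral do rewrite big_cons.
rewrite big_cons RintegralD//; [by rewrite IH|exact: bmeas_integrable|].
by apply: bmeas_integrable; exact: bmeas_sum.
Qed.

Lemma meanZ c h : bmeas h -> \int[mu]_x (c * h x) = c * \int[mu]_x h x.
Proof. by move=> bh; rewrite RintegralZl//; exact: bmeas_integrable. Qed.

Lemma mean_cst c : \int[mu]_x c = c.
Proof.
rewrite Rintegral_cst// [fine _](_ : _ = 1) ?mulr1//.
by rewrite -[RHS]/(fine 1%E); congr fine; exact: probability_setT.
Qed.

Lemma le_mean g h : bmeas g -> bmeas h -> (forall x, g x <= h x) ->
  \int[mu]_x g x <= \int[mu]_x h x.
Proof. by move=> bg bh gh; apply: le_Rintegral => //; exact: bmeas_integrable. Qed.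

Lemma integral_mean h : bmeas h -> (\int[mu]_x (h x)%:E = (\int[mu]_x h x)%:E)%E.
Proof.
move=> bh; rewrite fineK//; apply: integrable_fin_num => //.
exact: bmeas_integrable.
Qed.

End BoundedMeasurable.

(** * Exponential tails for sums of bounded functions of the sample *)

Section Tails.
Context {R : realType} {d : measure_display} {T : measurableType d}.
Variables (P : probability T R) (m : nat) (X : 'I_m -> {RV P >-> R}).
Hypothesis indep : mutually_independent X.
Variable mu : probability R R.
Hypothesis Xmu : forall j (B : set R), measurable B -> distribution P (X j) B = mu B.
Variables (h : R -> R) (B : R).
Hypotheses (mh : measurable_fun setT h) (B_gt0 : 0 < B) (h0B : forall x, 0 <= h x <= B).

Let bh : bmeas h.
Proof.
split=> //; exists B => x; have /andP[h0 hB] := h0B x.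
by rewrite ger0_norm.
Qed.

Lemma chernoff_mu (g : R -> R) (beta c : R) : bmeas g ->
  \int[mu]_x expR (g x) <= expR beta ->
  (P [set w | (c <= \sum_j g (X j w))%R] <= (expR (m%:R * beta - c))%:E)%E.
Proof.
move=> bg gb; apply: (chernoff indep); first by case: bg.
have be : bmeas (fun x => expR (g x)) by exact: bmeas_expR.
move=> j; rewrite (@ge0_integral_RV _ _ _ _ _ X mu Xmu j (fun x => (expR (g x))%:E)).
- by rewrite integral_mean// lee_fin.
- by apply/measurable_EFinP; case: be.
- by move=> x; rewrite lee_fin expR_ge0.
Qed.

(** Giving up half of the mean makes the exponent linear in $\tau/B$: for $0\le h\le B$ the mean of
    $e^{-h/B}$ is at most $1-\mathbb{E}h/(2B)\le e^{-\mathbb{E}h/(2B)}$, whatever the variance. *)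
Lemma lower_tail (tau : R) :
  (P [set w | (\sum_j h (X j w) <= m%:R * ((\int[mu]_x h x) / 2 - tau))%R] <=
   (expR (- (m%:R * tau / B)))%:E)%E.
Proof.
have bg : bmeas (fun x => - B^-1 * h x).
  exact: (bmeasM (bmeas_cst _) bh).
have := @chernoff_mu (fun x => - B^-1 * h x) (- ((\int[mu]_x h x) / (2 * B)))
  (- (m%:R * ((\int[mu]_x h x) / 2 - tau) / B)) bg.
set Eh := \int[mu]_x h x.
have -> : m%:R * - (Eh / (2 * B)) - - (m%:R * (Eh / 2 - tau) / B) = - (m%:R * tau / B).
  by field; rewrite gt_eqF.
rewrite (_ : [set w | (_ <= \sum_j (- B^-1 * h (X j w)))%R] =
  [set w | (\sum_j h (X j w) <= m%:R * (Eh / 2 - tau))%R]); last first.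
  apply/seteqP; split => w /=;
    by rewrite -mulr_sumr mulNr lerN2 [B^-1 * _]mulrC ler_pM2r ?invr_gt0.
apply; apply: (@le_trans _ _ (1 + - (Eh / (2 * B)))); last exact: expR_ge1Dx.
have -> : 1 + - (Eh / (2 * B)) = \int[mu]_x (1 + - (2 * B)^-1 * h x).
  rewrite RintegralD//.
  - by rewrite mean_cst meanZ// -/Eh mulNr mulrC.
  - exact: bmeas_integrable (bmeas_cst _).
  - exact: bmeas_integrable (bmeasM (bmeas_cst _) bh).
apply: le_mean.
- exact: bmeas_expR.
- exact: bmeasD (bmeas_cst _) (bmeasM (bmeas_cst _) bh).
- move=> x; have /andP[h0 hB] := h0B x.
  have v0 : 0 <= h x / B by rewrite divr_ge0// ltW.
  have v1 : h x / B <= 1 by rewrite ler_pdivrMr// mul1r.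
  rewrite mulNr [B^-1 * _]mulrC; apply: le_trans (expRN_le_half _) _.
    by rewrite v0 v1.
  by rewrite mulNr lerD2l lerN2 le_eqVlt; apply/orP; left; apply/eqP; field; rewrite gt_eqF.
Qed.

Lemma upper_tail : \int[mu]_x h x <= 1 ->
  (P [set w | (3 * m%:R <= \sum_j h (X j w))%R] <= (expR (- (m%:R / (2 * B))))%:E)%E.
Proof.
move=> Eh1.
have bg : bmeas (fun x => (2 * B)^-1 * h x).
  exact: (bmeasM (bmeas_cst _) bh).
have := @chernoff_mu (fun x => (2 * B)^-1 * h x) B^-1 (3 * m%:R / (2 * B)) bg.
have -> : m%:R * B^-1 - 3 * m%:R / (2 * B) = - (m%:R / (2 * B)).
  by field; rewrite gt_eqF.
rewrite (_ : [set w | (_ <= \sum_j ((2 * B)^-1 * h (X j w)))%R] =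
  [set w | (3 * m%:R <= \sum_j h (X j w))%R]); last first.
  by apply/seteqP; split => w /=; rewrite -mulr_sumr [(2 * B)^-1 * _]mulrC ler_pM2r ?invr_gt0 ?mulr_gt0.
apply; apply: (@le_trans _ _ (1 + B^-1)); last exact: expR_ge1Dx.
apply: (@le_trans _ _ (\int[mu]_x (1 + B^-1 * h x))); last first.
  rewrite RintegralD//.
  - by rewrite mean_cst meanZ// lerD2l ler_piMr// invr_ge0 ltW.
  - exact: bmeas_integrable (bmeas_cst _).
  - exact: bmeas_integrable (bmeasM (bmeas_cst _) bh).
apply: le_mean.
- exact: bmeas_expR.
- exact: bmeasD (bmeas_cst _) (bmeasM (bmeas_cst _) bh).
- move=> x; have /andP[h0 hB] := h0B x.
  have E : (2 * B)^-1 * h x = h x / B / 2 by field; rewrite gt_eqF.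
  have v0 : 0 <= h x / B by rewrite divr_ge0// ltW.
  have v1 : h x / B <= 1 by rewrite ler_pdivrMr// mul1r.
  rewrite E [B^-1 * _]mulrC; apply: le_trans (expR_le_quad _) _; first by lra.
  by nra.
Qed.

End Tails.

(** * The lower bound on a good sample and its probability *)

Section SignedSystem.
Context {R : realType} (n : nat) (y : 'I_n -> R -> R) (K : R).
Let U := ('I_n * bool)%type.

Definition signed (x : R) (u : U) : R := if u.2 then - y u.1 x else y u.1 x.

Definition weight (e : 'I_n -> R) (u : U) : R :=
  if u.2 == (e u.1 < 0) then `|e u.1| else 0.

Lemma weight_ge0 e u : 0 <= weight e u.
Proof. by rewrite /weight; case: ifP. Qed.

Lemma sum_signed (F : U -> R) : \sum_u F u = \sum_k (F (k, true) + F (k, false)).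
Proof.
transitivity (\sum_k \sum_b F (k, b)); last first.
  by apply: eq_bigr => k _; rewrite big_bool.
by rewrite pair_bigA; apply: eq_bigr => -[].
Qed.

Lemma weight_sum e : \sum_u weight e u = \sum_k `|e k|.
Proof.
rewrite sum_signed; apply: eq_bigr => k _; rewrite /weight /=.
by case: (ltP (e k) 0); rewrite /= ?addr0 ?add0r.
Qed.

Lemma weight_mean e x : \sum_u weight e u * signed x u = \sum_k e k * y k x.
Proof.
rewrite sum_signed; apply: eq_bigr => k _; rewrite /weight /signed /=.
case: (ltP (e k) 0) => ek /=.
  by rewrite mul0r addr0 ltr0_norm// mulrNN.
by rewrite mul0r add0r ger0_norm.
Qed.

Lemma weight_second e x :
  \sum_u weight e u * signed x u ^+ 2 = \sum_k `|e k| * y k x ^+ 2.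
Proof.
rewrite sum_signed; apply: eq_bigr => k _; rewrite /weight /signed /= sqrrN.
by case: (ltP (e k) 0) => ek /=; rewrite mul0r ?addr0 ?add0r.
Qed.

Variable mu : probability R R.
Hypotheses (K_gt0 : 0 < K) (my : forall k, measurable_fun setT (y k))
  (yK : forall k x, `|y k x| <= K)
  (ortho : forall j k, \int[mu]_x (y j x * y k x) = (j == k)%:R).

Lemma bmeas_y k : bmeas (y k).
Proof. by split => //; exists K. Qed.

Lemma signedK x u : `|signed x u| <= K.
Proof. by rewrite /signed; case: ifP => _; rewrite ?normrN. Qed.

Lemma mean_sqr (e : 'I_n -> R) :
  \int[mu]_x (\sum_k e k * y k x) ^+ 2 = \sum_k e k ^+ 2.
Proof.
under eq_Rintegral do rewrite expr2 big_distrlr /=.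
have b j k : bmeas (fun x => e j * y j x * (e k * y k x)).
  by apply: bmeasM; (apply: bmeasM; [exact: bmeas_cst|exact: bmeas_y]).
rewrite mean_sum => [|j]; last exact: bmeas_sum.
apply: eq_bigr => j _; rewrite mean_sum//.
rewrite (bigD1 j)//= [X in _ + X = _]big1 ?addr0 => [|k kj].
  under eq_Rintegral do rewrite mulrACA.
  by rewrite meanZ ?ortho ?eqxx ?mulr1//; apply: bmeasM; exact: bmeas_y.
under eq_Rintegral do rewrite mulrACA.
rewrite meanZ ?ortho; last by apply: bmeasM; exact: bmeas_y.
by rewrite eq_sym (negbTE kj) mulr0.
Qed.

Lemma mean_second (e : 'I_n -> R) :
  \int[mu]_x (\sum_k e k * y k x ^+ 2) = \sum_k e k.
Proof.
have b k : bmeas (fun x => y k x ^+ 2).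
  by under eq_fun do rewrite expr2; apply: bmeasM; exact: bmeas_y.
rewrite mean_sum => [|k]; last by apply: bmeasM => //; exact: bmeas_cst.
apply: eq_bigr => k _; rewrite meanZ//.
by under eq_Rintegral do rewrite expr2; rewrite ortho eqxx mulr1.
Qed.

Lemma measurable_theta L i : measurable_fun setT (theta K L i : R -> R).
Proof.
have [iL|iL] := ltnP i L.
  rewrite (_ : theta K L i = fun u =>
    if 3 / 8 * level K i <= `|u| then level K i ^+ 2 else 0); last first.
    by apply/funext => u; rewrite /theta iL.
  apply: measurable_fun_ifT => //.
  apply: measurable_fun_ler => //.
rewrite (_ : theta K L i = fun u => Num.min (u ^+ 2) (level K i ^+ 2)); last first.
  by apply/funext => u; rewrite /theta ltnNge iL.
by apply: measurable_minr => //; exact: measurable_funX.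
Qed.

Lemma bmeas_theta L i t (w : {ffun 'I_t -> U}) :
  bmeas (fun x => theta K L i (average w (signed x))).
Proof.
split.
  apply: measurableT_comp; first exact: measurable_theta.
  apply: measurable_funM => //; apply: measurable_sum => j.
  rewrite /signed; case: (w j) => k [] /=; last exact: my.
  by apply: measurableT_comp => //; exact: my.
exists (level K i ^+ 2) => x; rewrite ger0_norm ?theta_le//.
exact: theta_ge0.
Qed.

(** The sum [S] of the levels lies between multiples of $g^2$ up to [delta] times the second moment.
    The lower comparison is integrated, the upper one summed over the sample, and [Hlow], averaged
    with the weights of [e], links the two. The integral costs $\delta/4$ and the sample $3\delta$,
    whence $13/4$. *)
Lemma good_sample_lower_bound (m : nat) (x : 'I_m -> R) (k L : nat) (tau : nat -> R) :
  (2 <= k)%N ->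
  (forall i, (i < L.+1)%N -> forall w : {ffun 'I_(samples k i ^ 2) -> U},
    m%:R * ((\int[mu]_z theta K L i (average w (signed z))) / 2 - tau i) <=
    \sum_j theta K L i (average w (signed (x j)))) ->
  (forall k, \sum_j y k (x j) ^+ 2 <= 3 * m%:R) ->
  forall e : 'I_n -> R, \sum_k `|e k| = 1 ->
  m%:R * ((\sum_k e k ^+ 2) / 4 - 13 / 4 * sampling_error k L - \sum_(i < L.+1) tau i) <=
  24 * \sum_j (\sum_k e k * y k (x j)) ^+ 2.
Proof.
move=> k2 Hlow Hup e e1.
have p0 := weight_ge0 e.
have p1 : \sum_u weight e u = 1 by rewrite weight_sum.
set delta := sampling_error k L.
have d0 : 0 <= delta.
  by rewrite addr_ge0// ?mulr_ge0 ?invr_ge0 ?mulr_ge0 ?exprn_ge0.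
pose S z := \sum_(i < L.+1) level_mean (weight e) K L k (signed z) i.
have up z : S z <= 24 * (\sum_k e k * y k z) ^+ 2 + delta * \sum_k `|e k| * y k z ^+ 2.
  have := sum_levels_upper p0 p1 L K_gt0 (signedK z) k2.
  by rewrite weight_mean weight_second.
have low z : (\sum_k e k * y k z) ^+ 2 <= 2 * S z + delta * \sum_k `|e k| * y k z ^+ 2.
  have := sum_levels_lower p0 p1 L K_gt0 (signedK z) k2.
  by rewrite weight_mean weight_second.
have bl i : bmeas (fun z => level_mean (weight e) K L k (signed z) i).
  apply: bmeas_sum => w; apply: bmeasM; [exact: bmeas_cst|exact: bmeas_theta].
have bS : bmeas S by exact: bmeas_sum.
have b2 k' : bmeas (fun z => y k' z ^+ 2).
  by under eq_fun do rewrite expr2; apply: bmeasM; exact: bmeas_y.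
have bV : bmeas (fun z => \sum_k `|e k| * y k z ^+ 2).
  by apply: bmeas_sum => j; apply: bmeasM => //; exact: bmeas_cst.
have bf : bmeas (fun z => \sum_k e k * y k z).
  by apply: bmeas_sum => j; apply: bmeasM; [exact: bmeas_cst|exact: bmeas_y].
have ES : \sum_k e k ^+ 2 <= 2 * (\int[mu]_z S z) + delta.
  rewrite -mean_sqr.
  apply: (@le_trans _ _ (\int[mu]_z (2 * S z + delta * \sum_k `|e k| * y k z ^+ 2))).
    apply: le_mean => //.
      by under eq_fun do rewrite expr2; exact: bmeasM.
    by apply: bmeasD; (apply: bmeasM; first exact: bmeas_cst).
  rewrite RintegralD//.
  - by rewrite !meanZ// mean_second e1 mulr1.
  - by apply: bmeas_integrable; apply: bmeasM => //; exact: bmeas_cst.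
  - by apply: bmeas_integrable; apply: bmeasM => //; exact: bmeas_cst.
have sumS : m%:R * ((\int[mu]_z S z) / 2 - \sum_(i < L.+1) tau i) <= \sum_j S (x j).
  rewrite /S mean_sum// mulr_suml -sumrB mulr_sumr exchange_big/=.
  apply: ler_sum => i _; rewrite exchange_big/=.
  rewrite mean_sum => [|w]; last first.
    by apply: bmeasM; [exact: bmeas_cst|exact: bmeas_theta].
  apply: (@le_trans _ _ (\sum_w prodw (weight e) w *
     (m%:R * ((\int[mu]_z theta K L i (average w (signed z))) / 2 - tau i)))).
    have {1}-> : tau i = \sum_(w : {ffun 'I_(samples k i ^ 2) -> 'I_n * bool})
        prodw (weight e) w * tau i by rewrite -mulr_suml prodw_sum1 ?mul1r.
    rewrite mulr_suml -sumrB mulr_sumr.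
    rewrite le_eqVlt; apply/orP; left; apply/eqP; apply: eq_bigr => w _.
    rewrite meanZ; last exact: bmeas_theta.
    by ring.
  apply: ler_sum => w _; rewrite -mulr_sumr ler_wpM2l ?prodw_ge0//.
  exact: Hlow.
have VV : \sum_j \sum_k `|e k| * y k (x j) ^+ 2 <= 3 * m%:R.
  have -> : 3 * m%:R = \sum_k `|e k| * (3 * m%:R) by rewrite -mulr_suml e1 mul1r.
  rewrite exchange_big/=.
  by apply: ler_sum => j _; rewrite -mulr_sumr ler_wpM2l.
have UU : \sum_j S (x j) <= 24 * (\sum_j (\sum_k e k * y k (x j)) ^+ 2) +
    delta * \sum_j \sum_k `|e k| * y k (x j) ^+ 2.
  rewrite !mulr_sumr -big_split/=; apply: ler_sum => j _; exact: up.
have DV : delta * (\sum_j \sum_k `|e k| * y k (x j) ^+ 2) <= delta * (3 * m%:R).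
  by rewrite ler_wpM2l.
have m0 : 0 <= m%:R :> R by [].
have : m%:R * ((\sum_k e k ^+ 2) / 4 - delta / 4) <= m%:R * ((\int[mu]_z S z) / 2).
  by rewrite ler_wpM2l//; lra.
move: sumS; rewrite !mulrBr; lra.
Qed.

End SignedSystem.

(** * Union bound over all averages *)

Section UnionBound.
Context {R : realType} {d : measure_display} {T : measurableType d}.
Variable P : probability T R.

Lemma union_bound (I : finType) (F : I -> set T) (p : I -> R) :
  (forall i, measurable (F i)) -> (forall i, (P (F i) <= (p i)%:E)%E) ->
  exists E : set T, [/\ measurable E, forall i, F i `<=` E &
    (P E <= (\sum_i p i)%:E)%E].
Proof.
move=> mF Fp.
suff [E [mE FE PE]] : exists E : set T, [/\ measurable E,
    forall i, i \in index_enum I -> F i `<=` E &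
    (P E <= (\sum_(i <- index_enum I) p i)%:E)%E].
  by exists E; split => // i; apply: FE; rewrite mem_index_enum.
elim: (index_enum I) => [|i r [E [mE FE PE]]].
  by exists set0; split => //; rewrite measure0 big_nil.
exists (F i `|` E); split; first exact: measurableU.
- move=> j; rewrite in_cons => /predU1P[->|/FE jE]; first exact: subsetUl.
  by apply: subset_trans jE _; exact: subsetUr.
- rewrite big_cons EFinD; apply: le_trans (measureU2 _ _ _) _ => //.
  by apply: leeD => //; exact: Fp.
Qed.

Variables (m : nat) (X : 'I_m -> {RV P >-> R}).
Hypothesis indep : mutually_independent X.
Variable mu : probability R R.
Hypothesis Xmu : forall j (B : set R), measurable B -> distribution P (X j) B = mu B.
Variables (n : nat) (y : 'I_n -> R -> R) (K : R).
Hypotheses (K_gt0 : 0 < K) (my : forall k, measurable_fun setT (y k))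
  (yK : forall k x, `|y k x| <= K)
  (ortho : forall j k, \int[mu]_x (y j x * y k x) = (j == k)%:R).

Lemma measurable_sum_RV (h : R -> R) : measurable_fun setT h ->
  measurable_fun setT (fun w => \sum_j h (X j w)).
Proof. by move=> mh; apply: measurable_sum => j; exact: (measurable_RV_comp X j mh). Qed.

Lemma measurable_le_cst (g : T -> R) c : measurable_fun setT g ->
  measurable [set w | g w <= c].
Proof.
move=> mg; rewrite (_ : [set w | _] = g @^-1` `]-oo, c]); last first.
  by apply/seteqP; split => w /=; rewrite in_itv.
by rewrite -[X in measurable X]setTI; exact: mg.
Qed.

Lemma measurable_ge_cst (g : T -> R) c : measurable_fun setT g ->
  measurable [set w | c <= g w].
Proof.
move=> mg; rewrite (_ : [set w | _] = g @^-1` `[c, +oo[); last first.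
  by apply/seteqP; split => w /=; rewrite in_itv/= andbT.
by rewrite -[X in measurable X]setTI; exact: mg.
Qed.

(** Level $i$ has $(2n)^t$ words of length $t$ in the signed system. The last summand guards the
    empirical second moments of the [y k], which keeps the total sampling error at the sample points
    below a constant multiple of $m$ times [sampling_error]. *)
Lemma bad_event (k L : nat) (tau : nat -> R) :
  exists E : set T, [/\ measurable E,
    (P E <= (\sum_(i < L.+1) (2 * n%:R) ^+ (samples k i ^ 2) *
               expR (- (m%:R * tau i / level K i ^+ 2)) +
             n%:R * expR (- (m%:R / (2 * K ^+ 2))))%:E)%E &
    forall w, ~ E w ->
      (forall i, (i < L.+1)%N ->
        forall u : {ffun 'I_(samples k i ^ 2) -> 'I_n * bool},
        m%:R * ((\int[mu]_z theta K L i (average u (signed y z))) / 2 - tau i) <=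
        \sum_j theta K L i (average u (signed y (X j w)))) /\
      (forall k, \sum_j y k (X j w) ^+ 2 <= 3 * m%:R)].
Proof.
have level_event (i : 'I_L.+1) : exists E : set T, [/\ measurable E,
    (P E <= ((2 * n%:R) ^+ (samples k i ^ 2) *
               expR (- (m%:R * tau i / level K i ^+ 2)))%:E)%E &
    forall w, ~ E w -> forall u : {ffun 'I_(samples k i ^ 2) -> 'I_n * bool},
        m%:R * ((\int[mu]_z theta K L i (average u (signed y z))) / 2 - tau i) <=
        \sum_j theta K L i (average u (signed y (X j w)))].
  pose F (u : {ffun 'I_(samples k i ^ 2) -> 'I_n * bool}) :=
    [set w | \sum_j theta K L i (average u (signed y (X j w))) <=
     m%:R * ((\int[mu]_z theta K L i (average u (signed y z))) / 2 - tau i)].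
  have mth u := (bmeas_theta K my L i u).1.
  have mF u : measurable (F u).
    by apply: measurable_le_cst; exact: (measurable_sum_RV (mth (samples k i ^ 2)%N u)).
  have PF u : (P (F u) <= (expR (- (m%:R * tau i / level K i ^+ 2)))%:E)%E.
    apply: (lower_tail indep Xmu (mth _ u)); first by rewrite exprn_gt0// level_gt0.
    by move=> x; rewrite theta_ge0 theta_le.
  have [E [mE FE PE]] := union_bound mF PF.
  exists E; split => //.
    move: PE; rewrite sumr_const card_ffun card_prod !card_ord card_bool.
    by rewrite -[expR _ *+ _]mulr_natl natrX natrM [n%:R * _]mulrC.
  by move=> w Ew u; rewrite leNgt; apply/negP => h; apply: Ew; apply: (FE u); exact: ltW.
have [Ei EiP] := choice level_event.
have mEi i : measurable (Ei i) by have [] := EiP i.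
have PEi i : (P (Ei i) <= ((2 * n%:R) ^+ (samples k i ^ 2) *
    expR (- (m%:R * tau i / level K i ^+ 2)))%:E)%E by have [] := EiP i.
have [E1 [mE1 EE1 PE1]] := union_bound mEi PEi.
pose G k' := [set w | 3 * m%:R <= \sum_j y k' (X j w) ^+ 2].
have m2 k' : measurable_fun setT (fun x => y k' x ^+ 2) by exact: measurable_funX.
have mG k' : measurable (G k').
  by apply: measurable_ge_cst; exact: (measurable_sum_RV (m2 k')).
have PG k' : (P (G k') <= (expR (- (m%:R / (2 * K ^+ 2))))%:E)%E.
  apply: (upper_tail indep Xmu (m2 k')); first by rewrite exprn_gt0.
    move=> x; rewrite sqr_ge0/= -[y k' x ^+ 2]real_normK ?num_real//.
    by apply: lerXn2r; rewrite ?nnegrE// ltW.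
  by under eq_Rintegral do rewrite expr2; rewrite ortho eqxx.
have [E2 [mE2 EE2 PE2]] := union_bound mG PG.
exists (E1 `|` E2); split; first exact: measurableU.
  apply: le_trans (measureU2 _ _ _) _ => //; rewrite EFinD; apply: leeD => //.
  by move: PE2; rewrite sumr_const card_ord -[expR _ *+ _]mulr_natl.
move=> w Ew; split => [i iL u|k'].
  have [_ _] := EiP (Ordinal iL); move=> /(_ w) /= H; apply: H => Eiw.
  by apply: Ew; left; apply: (EE1 (Ordinal iL)).
rewrite leNgt; apply/negP => h; apply: Ew; right; apply: (EE2 k').
exact: ltW.
Qed.

End UnionBound.

(** * Numerical constants and the failure probability *)

Section Constants.
Context {R : realType}.

(* The part [2 ^- i.+1] secures the failure probability at the coarse levels,
   where there are few averages; the part [L.+1^-1] beats the number of averages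
   at the fine levels. *)
Definition tolerance (s L i : nat) : R :=
  (512 * s%:R)^-1 * (2 ^- i.+1 + L.+1%:R^-1).

Lemma ln_ge_half (n : nat) : (2 <= n)%N -> 1 / 2 <= ln n%:R :> R.
Proof.
move=> n2; have e2 : expR (1 / 2) <= 2 :> R.
  by apply: le_trans (expR_le_quad _) _ => //; lra.
rewrite -[1 / 2]expRK ler_ln ?posrE ?expR_gt0 ?ltr0n//; last by lia.
by apply: le_trans e2 _; rewrite ler_nat.
Qed.

Lemma up_log_le_ln (s : nat) : (2 <= s)%N -> (up_log 2 s)%:R <= 4 * ln s%:R :> R.
Proof.
move=> s2; have l0 : (0 < up_log 2 s)%N by rewrite up_log_gt0.
have a2 := ln_ge_half s2.
have h : (2 ^ (up_log 2 s).-1 < s)%N by rewrite ltnNge; apply/negP => /(up_log_min (ltnSn 1)); lia.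
suff : (up_log 2 s).-1%:R * (1 / 2) <= ln s%:R :> R.
  have : (up_log 2 s)%:R = (up_log 2 s).-1%:R + 1 :> R by rewrite natr1 prednK.
  by move=> *; lra.
apply: (@le_trans _ _ ((up_log 2 s).-1%:R * ln 2)).
  by rewrite ler_wpM2l// (ln_ge_half (leqnn 2)).
rewrite mulr_natl -lnXn// ler_ln ?posrE ?exprn_gt0 ?ltr0n//; last by lia.
by rewrite -natrX ler_nat ltnW.
Qed.

(** Half of the budget $1/(128s)$ pays the tolerances, whose two parts each sum to at most
    $1/(512s)$. The other half pays the sampling error, where the shift 12 makes
    $2^{-k}\le1/(4096s)$ and $k^2\ge144$. *)
Lemma error_bound (s : nat) : (2 <= s)%N -> let L := up_log 2 s in
  (13 / 4 * sampling_error (L + 12) L + \sum_(i < L.+1) tolerance s L i <=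
  (128 * s%:R)^-1 :> R)%R : Prop.
Proof.
move=> s2 L.
have s0 : 0 < s%:R :> R by rewrite ltr0n; lia.
have sL : s%:R <= 2 ^+ L :> R by rewrite -natrX ler_nat; exact: up_logP.
pose v : R := s%:R^-1; pose p : R := 2 ^- L.
have s0' : s%:R != 0 :> R by rewrite gt_eqF.
have v0 : 0 < v by rewrite invr_gt0.
have p0 : 0 < p by rewrite invr_gt0 exprn_gt0.
have pv : p <= v by rewrite lef_pV2 ?posrE ?exprn_gt0.
have T : \sum_(i < L.+1) tolerance s L i <= v / 256.
  have S1 j : \sum_(i < j) 2 ^- i.+1 = 1 - 2 ^- j :> R.
    elim: j => [|j IH]; first by rewrite big_ord0 expr0 invr1 subrr.
    by rewrite big_ord_recr /= IH exprS; field; rewrite expf_neq0.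
  rewrite -mulr_sumr big_split/= S1 sumr_const card_ord -[_ *+ L.+1]mulr_natr mulVf ?pnatr_eq0//.
  have -> : (512 * s%:R)^-1 = v / 512 by rewrite /v; field.
  have : 0 <= v * 2 ^- L.+1 by rewrite mulr_ge0 ?invr_ge0 ?exprn_ge0 // ltW.
  by move=> *; lra.
have D1 : 4 / 3 * 2 ^- (L + 12) = p / 3072 :> R.
  by rewrite /p exprD; field; rewrite expf_neq0.
have D2 : (16 * (L + 12)%N%:R ^+ 2 * 4 ^+ L)^-1 <= p / 2304 :> R.
  have k12 : 12 <= (L + 12)%N%:R :> R by rewrite ler_nat leq_addl.
  have k2 : 144 <= (L + 12)%N%:R ^+ 2 :> R by nra.
  have p24 : 2 ^+ L <= 4 ^+ L :> R by apply: lerXn2r; rewrite ?nnegrE//; lra.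
  have p2 : 0 < 2 ^+ L :> R by rewrite exprn_gt0.
  have -> : p / 2304 = (2304 * 2 ^+ L)^-1 by rewrite /p; field; rewrite gt_eqF.
  have A0 : 0 < 2304 * 2 ^+ L :> R by lra.
  have AB : 2304 * 2 ^+ L <= 16 * (L + 12)%N%:R ^+ 2 * 4 ^+ L :> R.
    have -> : 2304 * 2 ^+ L = 16 * 144 * 2 ^+ L :> R by ring.
    by apply: ler_pM => //; lra.
  by rewrite lef_pV2 ?posrE//; exact: lt_le_trans AB.
have -> : (128 * s%:R)^-1 = v / 128 by rewrite /v; field.
by rewrite /sampling_error; lra.
Qed.

(** The cube of the logarithm: two powers from the square of $k=L+12$ in the length of an average,
    one from the number of levels sharing the tolerance. The constant is $338=13^2\cdot2$. *)
Lemma samples_le (L : nat) (a : R) : 1 <= L%:R :> R -> L%:R <= 4 * a ->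
  (L + 12)%N%:R ^+ 2 * L.+1%:R <= 338 * (64 * a ^+ 3).
Proof.
move=> L1 La.
have k13 : (L + 12)%N%:R <= 13 * L%:R :> R by rewrite natrD; lra.
have k0 : 0 <= (L + 12)%N%:R :> R by [].
have kk : (L + 12)%N%:R ^+ 2 <= 169 * L%:R ^+ 2 :> R by nra.
have LS : L.+1%:R <= 2 * L%:R :> R by rewrite -natr1; lra.
have L3 : L%:R ^+ 3 <= 64 * a ^+ 3 :> R.
  have -> : 64 * a ^+ 3 = (4 * a) ^+ 3 by ring.
  by apply: lerXn2r; rewrite ?nnegrE//; lra.
have : (L + 12)%N%:R ^+ 2 * L.+1%:R <= 169 * L%:R ^+ 2 * (2 * L%:R) :> R.
  by apply: ler_pM => //; exact: sqr_ge0.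
have -> : 169 * L%:R ^+ 2 * (2 * L%:R) = 338 * L%:R ^+ 3 :> R by ring.
by move=> M; lra.
Qed.

Lemma failure_bound (n m s : nat) (K D : R) : (2 <= n)%N -> (2 <= s)%N -> 1 <= K ->
  194 <= D -> (forall x, 0 <= x -> 2 * (32 ^+ 2 * (338 * (64 * x))) <= D * x) ->
  512 * D * K ^+ 2 * s%:R * ln s%:R ^+ 3 * ln n%:R <= m%:R ->
  let L := up_log 2 s in
  (\sum_(i < L.+1) (2 * n%:R) ^+ (samples (L + 12) i ^ 2) *
     expR (- (m%:R * tolerance s L i / level K i ^+ 2)) +
   n%:R * expR (- (m%:R / (2 * K ^+ 2))) <=
  n%:R `^ (- (1 * ln s%:R ^+ 3)))%R : Prop.
Proof.
move=> n2 s2.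
have s0 : 0 < s%:R :> R by rewrite ltr0n; lia.
have n0 : 0 < n%:R :> R by rewrite ltr0n; lia.
have s1 : 1 <= s%:R :> R by rewrite ler1n; lia.
pose a : R := ln s%:R; pose l : R := ln n%:R; pose Y := a ^+ 3 * l.
have a2 : 1 / 2 <= a := ln_ge_half s2.
have l2 : 1 / 2 <= l := ln_ge_half n2.
have l0 : 0 <= l by lra.
have aa : a / 4 <= a ^+ 3 by have : 0 <= a * (a - 1/2) * (a + 1/2); [rewrite !mulr_ge0//; lra|nra].
have a0 : 0 <= a ^+ 3 by lra.
have Y0 : 0 < Y by rewrite mulr_gt0; lra.
have lY : l <= 8 * Y by rewrite /Y; nra.
have aY : a / 8 <= Y by rewrite /Y; nra.
move=> K1 D194 D64 mC L.
have K0 : 0 < K by apply: lt_le_trans K1.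
have K2 : 0 < K ^+ 2 by rewrite exprn_gt0.
have La : L%:R <= 4 * a := up_log_le_ln s2.
have L1 : 1 <= L%:R :> R by rewrite ler1n up_log_gt0.
(* The size of [D] is dictated here: after removal of the common factor $4^i$, the share $1/(L+1)$
   of the tolerance outweighs the logarithm of the number of averages. *)
have p2 : 2 * ((32 * (L + 12)%N%:R) ^+ 2 * l) <= D * Y * L.+1%:R^-1.
  rewrite ler_pdivlMr// /Y [D * _]mulrA.
  rewrite (_ : 2 * _ * _ = 2 * (32 ^+ 2 * ((L + 12)%N%:R ^+ 2 * L.+1%:R)) * l); last by ring.
  apply: ler_wpM2r => //; apply: le_trans (D64 _ a0).
  apply: ler_wpM2l; first exact: ler0n.
  apply: ler_wpM2l; first exact: sqr_ge0.
  exact: samples_le.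
have mK : 512 * (D * Y * s%:R) <= m%:R / K ^+ 2.
  rewrite ler_pdivlMr//; apply: le_trans mC; rewrite /Y /a /l.
  by rewrite le_eqVlt; apply/orP; left; apply/eqP; ring.
clear D64 mC.
have nE : n%:R = expR l by rewrite lnK// posrE.
have step (i : 'I_L.+1) : (2 * n%:R) ^+ (samples (L + 12) i ^ 2) *
     expR (- (m%:R * tolerance s L i / level K i ^+ 2)) <= expR (- (D / 2 * Y)).
  have q4 : 0 < 4 ^+ i :> R by rewrite exprn_gt0.
  have q2 : 1 <= 2 ^+ i :> R by rewrite exprn_ege1// ler1n.
  have q24 : 4 ^+ i = 2 ^+ i * 2 ^+ i :> R.
    by rewrite -exprMn; congr (_ ^+ _); ring.
  set t := (samples (L + 12) i ^ 2)%N.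
  apply: (@le_trans _ _ (expR (2 * t%:R * l) *
     expR (- (m%:R * tolerance s L i / level K i ^+ 2)))).
    rewrite ler_pM2r ?expR_gt0//.
    have -> : 2 * t%:R * l = t%:R * (l + l) by ring.
    have nn : 2 * n%:R <= n%:R * n%:R :> R by rewrite ler_pM2r// (ler_nat _ 2).
    by rewrite expRM_natl expRD -nE; apply: lerXn2r; rewrite ?nnegrE ?mulr_ge0.
  rewrite -expRD ler_expR.
  have tE : t%:R = (32 * (L + 12)%N%:R) ^+ 2 * 4 ^+ i :> R.
    by rewrite /t /samples !natrX !natrM natrX q24; ring.
  have lE : level K i ^+ 2 = K ^+ 2 / 4 ^+ i.
    by rewrite /level expr_div_n q24 -[2 ^+ i * _]expr2.
  have mt : D * Y * (4 ^+ i * (2 ^- i.+1 + L.+1%:R^-1)) <=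
      m%:R * tolerance s L i / level K i ^+ 2.
    have -> : m%:R * tolerance s L i / level K i ^+ 2 =
        m%:R / K ^+ 2 * (tolerance s L i * 4 ^+ i).
      by rewrite lE; field; rewrite !gt_eqF.

    have tol0 : 0 <= tolerance s L i * 4 ^+ i.
      apply: mulr_ge0 (ltW q4); apply: mulr_ge0; first by rewrite invr_ge0; lra.
      by apply: addr_ge0; rewrite invr_ge0 ?ler0n// exprn_ge0// ler0n.
    apply: le_trans (ler_wpM2r tol0 mK).
    rewrite /tolerance le_eqVlt; apply/orP; left; apply/eqP.
    set z := _ + _; have s0' : s%:R != 0 :> R by rewrite gt_eqF.
    by field.
  have p1 : 1 / 2 <= 4 ^+ i * 2 ^- i.+1 :> R.
    have -> : 4 ^+ i * 2 ^- i.+1 = 2 ^+ i / 2 :> R.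
      by rewrite q24 exprS; field; rewrite gt_eqF// (lt_le_trans _ q2).
    by lra.
  have DY : 0 <= D * Y by rewrite mulr_ge0 ?(ltW Y0)// (le_trans _ D194)// ler0n.
  have h1 : D / 2 * Y <= D * Y * (4 ^+ i * 2 ^- i.+1).
    by have -> : D / 2 * Y = D * Y * (1 / 2); [field|rewrite ler_wpM2l].
  have h2 : 2 * t%:R * l <= D * Y * (4 ^+ i * L.+1%:R^-1).
    have -> : 2 * t%:R * l = 2 * ((32 * (L + 12)%N%:R) ^+ 2 * l) * 4 ^+ i by rewrite tE; ring.
    have -> : D * Y * (4 ^+ i / L.+1%:R) = D * Y * L.+1%:R^-1 * 4 ^+ i by ring.
    by rewrite ler_pM2r.
  rewrite mulrDr [D * Y * (_ + _)]mulrDr in mt.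
  rewrite -lerBrDr opprK addrC lerBrDr; apply: le_trans mt; rewrite addrC.
  by rewrite lerD.
have DY : 194 * Y <= D * Y by rewrite ler_pM2r.
have tail : n%:R * expR (- (m%:R / (2 * K ^+ 2))) <= expR (- (D / 2 * Y)).
  rewrite nE -expRD ler_expR.
  have -> : m%:R / (2 * K ^+ 2) = m%:R / K ^+ 2 / 2 by field; rewrite gt_eqF.
  have : D * Y <= D * Y * s%:R.
    by rewrite ler_peMr// (le_trans _ DY)// mulr_ge0 ?(ltW Y0)// ler0n.
  by lra.
have -> : n%:R `^ (- (1 * ln s%:R ^+ 3)) = expR (- Y) :> R.
  by rewrite /powR gt_eqF// mul1r mulNr.
apply: (@le_trans _ _ (L.+2%:R * expR (- (D / 2 * Y)))).
  apply: le_trans (lerD (ler_sum _ (fun i _ => step i)) tail) _.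
  by rewrite sumr_const card_ord -mulrSr mulr_natl.
(* There are $L+1$ levels and one second-moment term, each at most $e^{-DY/2}$. As $D\ge194$ this is
   at most $e^{-97Y}$: a part $96Y$ of the exponent absorbs the number of terms and $Y$ remains. *)
have L2 : L.+2%:R <= expR (96 * Y).
  apply: le_trans (expR_ge1Dx _).
  have -> : L.+2%:R = L%:R + 2 :> R by rewrite -addn2 natrD.
  by lra.
apply: (@le_trans _ _ (expR (96 * Y) * expR (- (D / 2 * Y)))).
  by rewrite ler_pM2r ?expR_gt0.
rewrite -expRD ler_expR.
by lra.
Qed.

End Constants.

(** * Sparse recovery *)

Section Recovery.
Context {R : realType}.

Lemma vnorm1E n (z : 'cV[R]_n) : vnorm 1 z = \sum_k `|z k 0|.
Proof.
rewrite /vnorm invr1 powRr1; last by apply: sumr_ge0 => k _; exact: powR_ge0.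
by apply: eq_bigr => k _; rewrite powRr1.
Qed.

Lemma vnorm2_le n (z : 'cV[R]_n) (c : R) : 0 <= c ->
  (vnorm 2 z <= c) = (\sum_k z k 0 ^+ 2 <= c ^+ 2).
Proof.
move=> c0; have s0 : 0 <= \sum_k z k 0 ^+ 2 by apply: sumr_ge0 => k _; exact: sqr_ge0.
rewrite /vnorm (_ : \sum_k _ = \sum_k z k 0 ^+ 2); last first.
  by apply: eq_bigr => k _; rewrite (powR_mulrn 2)// real_normK ?num_real.
by rewrite powR12_sqrt// -{1}(ger0_norm c0) -sqrtr_sqr ler_sqrt ?sqr_ge0.
Qed.

(** Thresholding instead of sorting. With $t=\|c\|_q s^{-1/q}$, at most $s$ entries exceed $t$ by
    Markov's inequality, and the others satisfy $|c_k|\le t^{1-q}|c_k|^q$. *)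
Lemma stechkin n (c : 'cV[R]_n) (q : R) (s : nat) : 0 < q -> q < 1 -> (0 < s)%N ->
  exists2 S : {set 'I_n}, (#|S| <= s)%N &
    \sum_(k | k \notin S) `|c k 0| <= vnorm q c * s%:R `^ (1 - q^-1).
Proof.
move=> q0 q1 s0; have s0' : 0 < s%:R :> R by rewrite ltr0n.
have qn0 : q != 0 by rewrite gt_eqF.
pose W := \sum_k `|c k 0| `^ q.
have W0 : 0 <= W by apply: sumr_ge0 => k _; exact: powR_ge0.
pose t := vnorm q c * s%:R `^ (- q^-1).
have t0 : 0 <= t by rewrite mulr_ge0 ?powR_ge0.
have tq : t `^ q * s%:R = W.
  rewrite /t powRM ?powR_ge0// /vnorm -!powRrM mulVf// powRr1// mulNr mulVf//.
  by rewrite powRN powRr1 ?ltW// mulfVK// gt_eqF.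
exists [set k | t < `|c k 0|]%SET.
  have le1 : t `^ q * #|[set k | t < `|c k 0|]%SET|%:R <= W.
    rewrite mulr_natr -sumr_const /W [leRHS](bigID (mem [set k | t < `|c k 0|]%SET))/=.
    apply: ler_wpDr; first by apply: sumr_ge0 => k _; exact: powR_ge0.
    apply: ler_sum => k; rewrite inE => tk; apply: ge0_ler_powR => //; rewrite ?nnegrE//; exact: ltW.
  (* If $t=0$ the counting inequality is void, but then [W] vanishes and no entry exceeds 0. *)
  have [t00|tn0] := eqVneq t 0.
    have W00 : W = 0 by rewrite -tq t00 powR0// mul0r.
    suff -> : [set k | t < `|c k 0|]%SET = finset.set0 by rewrite cards0.
    apply/setP => k; rewrite !inE t00; apply/negP => ck.
    have : `|c k 0| `^ q <= W.
      by rewrite /W (bigD1 k)//= lerDl sumr_ge0// => j _; exact: powR_ge0.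
    by rewrite W00 leNgt powR_gt0.
  have tq0 : 0 < t `^ q by rewrite powR_gt0// lt0r tn0.
  by move: le1; rewrite -tq ler_pM2l// ler_nat.
have -> : vnorm q c * s%:R `^ (1 - q^-1) = t `^ (1 - q) * W.
  rewrite -tq mulrA -powRD; last by rewrite subrK oner_eq0.
  rewrite subrK powRr1// /t -mulrA; congr (_ * _).
  rewrite powRD; last by rewrite (gt_eqF s0') implybT.
  by rewrite powRr1 ?ltW// mulrC.
rewrite /W mulr_sumr [leRHS](bigID (fun k => k \notin [set k | t < `|c k 0|]%SET))/=.
apply: ler_wpDr; first by apply: sumr_ge0 => k _; rewrite mulr_ge0 ?powR_ge0.
apply: ler_sum => k; rewrite inE -leNgt => ct.
have [->|cn0] := eqVneq (`|c k 0|) 0; first by rewrite mulr_ge0 ?powR_ge0.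
apply: (@le_trans _ _ (`|c k 0| `^ (1 - q) * `|c k 0| `^ q)).
  by rewrite -powRD ?subrK ?powRr1// oner_eq0.
rewrite ler_wpM2r ?powR_ge0//; apply: ge0_ler_powR; rewrite ?nnegrE//; lra.
Qed.

Lemma sum_sqr_le n (S : {set 'I_n}) (e : 'I_n -> R) :
  (\sum_(k in S) e k) ^+ 2 <= #|S|%:R * \sum_(k in S) e k ^+ 2.
Proof.
rewrite expr2 big_distrlr /=.
apply: (@le_trans _ _ (\sum_(i in S) \sum_(j in S) (e i ^+ 2 / 2 + e j ^+ 2 / 2))).
  apply: ler_sum => i _; apply: ler_sum => j _.
  by have := sqr_ge0 (e i - e j); move=> *; nra.
have h : \sum_(i in S) \sum_(j in S) e i ^+ 2 / 2 =
    #|S|%:R * (\sum_(k in S) e k ^+ 2) / 2.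
  under eq_bigr do rewrite sumr_const -[_ *+ _]mulr_natl.
  by rewrite -mulr_sumr -mulr_suml mulrA.
rewrite (eq_bigr (fun i => \sum_(j in S) e i ^+ 2 / 2 + \sum_(j in S) e j ^+ 2 / 2));
  last by move=> i _; rewrite big_split.
rewrite big_split/= h [X in _ + X]exchange_big/= h; lra.
Qed.

(* A vector of small l1/l2 ratio is controlled by the lower bound on A; any
   other vector has less than a quarter of its l1 norm on S, and then the l1
   minimality alone controls it. *)
Lemma l1_recovery n (c e : 'I_n -> R) (S : {set 'I_n}) (s : nat) (M Q eta : R) :
  (#|S| <= s)%N -> 0 < M -> 0 <= eta ->
  \sum_k `|c k + e k| <= \sum_k `|c k| ->
  ((\sum_k `|e k|) ^+ 2 <= 16 * s%:R * \sum_k e k ^+ 2 -> M * (\sum_k e k ^+ 2) <= 192 * Q) ->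
  Q <= 4 * M * eta ^+ 2 ->
  \sum_k `|e k| <= 4 * (\sum_(k | k \notin S) `|c k|) + 112 * Num.sqrt s%:R * eta.
Proof.
move=> Ss M0 eta0 mn lb Qle.
have [ratio|ratio] := leP ((\sum_k `|e k|) ^+ 2) (16 * s%:R * \sum_k e k ^+ 2).
  have c0 : 0 <= \sum_(k | k \notin S) `|c k| by rewrite sumr_ge0.
  have r0 : 0 <= 112 * Num.sqrt s%:R * eta by rewrite !mulr_ge0// sqrtr_ge0.
  apply: ler_wpDl; first by rewrite mulr_ge0.
  rewrite -[leLHS]ger0_norm ?sumr_ge0// -[leRHS]ger0_norm// -ler_sqr; last 2 first.
  - by rewrite nnegrE.
  - by rewrite nnegrE.
  rewrite !real_normK ?num_real//.
  rewrite !exprMn sqr_sqrtr//.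
  (* Here $768=192\cdot4$, and $16\cdot768=12288\le112^2$ is the origin of 112. *)
  have e2 : \sum_k e k ^+ 2 <= 768 * eta ^+ 2.
    rewrite -(ler_pM2l M0); have := lb ratio; lra.
  apply: le_trans ratio _.
  have : 16 * s%:R * (\sum_k e k ^+ 2) <= 16 * s%:R * (768 * eta ^+ 2).
    by rewrite ler_wpM2l// mulr_ge0.
  have : 0 <= s%:R * eta ^+ 2 by rewrite mulr_ge0 ?sqr_ge0.
  by move=> *; lra.
have e2S : \sum_(k in S) `|e k| ^+ 2 <= \sum_k e k ^+ 2.
  rewrite [leRHS](bigID (mem S))/=; apply: ler_wpDr.
    by apply: sumr_ge0 => k _; exact: sqr_ge0.
  by apply: ler_sum => k _; rewrite real_normK ?num_real.
set N := \sum_k `|e k| in ratio *.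
have N0 : 0 <= N by exact: sumr_ge0.
set NS := \sum_(k in S) `|e k|; set NC := \sum_(k | k \notin S) `|e k|.
have NE : N = NS + NC by rewrite /N (bigID (mem S)).
have NS0 : 0 <= NS by exact: sumr_ge0.
have small : NS <= N / 4.
  rewrite leNgt; apply/negP => big.
  have : 16 * NS ^+ 2 <= 16 * s%:R * \sum_k e k ^+ 2.
    rewrite -mulrA ler_pM2l//; apply: le_trans (sum_sqr_le _ _) _.
    apply: ler_pM => //; last by rewrite ler_nat.
    by apply: sumr_ge0 => k _; exact: sqr_ge0.
  by nra.
(* Minimality split along [S]. With $\sigma$ the l1 norm of [c] off [S], this and [small] give
   $N\le2N_S+2\sigma\le N/2+2\sigma$, hence the factor 4. *)
have cone : NC <= NS + 2 * \sum_(k | k \notin S) `|c k|.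
  move: mn; rewrite (bigID (mem S))/= [leRHS](bigID (mem S))/=.
  have h1 : \sum_(k in S) `|c k| - NS <= \sum_(k in S) `|c k + e k|.
    by rewrite -sumrB; apply: ler_sum => k _; rewrite lerBlDr -{1}[c k](addrK (e k)) ler_normB.
  have h2 : NC - \sum_(k | k \notin S) `|c k| <= \sum_(k | k \notin S) `|c k + e k|.
    by rewrite -sumrB; apply: ler_sum => k _; rewrite lerBlDr -{1}[e k](addKr (c k)) addrC ler_normB.
  by move=> *; lra.
have : 0 <= 112 * Num.sqrt s%:R * eta by rewrite !mulr_ge0// sqrtr_ge0.
by lra.
Qed.

End Recovery.

(** * Integration against a density *)

Section Density.
Context {R : realType} (a b : R) (nu : R -> R) (mu : probability R R).
Hypothesis nu_density : prob_density a b nu.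
Hypothesis mu_nu : forall B : set R, measurable B ->
  mu B = (\int[lebesgue_measure]_(x in B `&` `[a, b]) (nu x)%:E)%E.
Import HBNNSimple.

Lemma density_integral_simple (g : {nnsfun R >-> R}) :
  (\int[mu]_x (g x)%:E =
   \int[lebesgue_measure]_(x in `[a, b]) (g x * nu x)%:E)%E.
Proof.
have [mnu nu0 _] := nu_density.
pose s := fset_set (range g); pose c (i : 'I_#|` s|) := s`_i.
pose B (i : 'I_#|` s|) : set R := g @^-1` [set c i].
have gE x : g x = \sum_i c i * \1_(B i) x by rewrite fimfunEord.
have c0 i : 0 <= c i.
  have : c i \in s by apply: mem_nth.
  by move=> h; have := h; rewrite /s in_fset_set// => /set_mem[x _ <-]; exact: fun_ge0.
have mB i : measurable (B i) by exact: measurable_funPTI.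
rewrite (eq_integral (fun x => (\sum_i c i * \1_(B i) x)%:E)); last first.
  by move=> x _; rewrite gE.
rewrite integral_sum_indic//.
transitivity (\int[lebesgue_measure]_(x in `[a, b])
    (\sum_i (c i)%:E * (\1_(B i) x * nu x)%:E))%E; last first.
  apply: eq_integral => x _; rewrite gE mulr_suml -sumEFin; apply: eq_bigr => i _.
  by rewrite -EFinM mulrA.
have mi i : measurable_fun `[a, b] (fun x => (\1_(B i) x * nu x)%:E).
  by apply/measurable_EFinP; apply: measurable_funM => //; exact: measurable_funTS.
have i0 i x : x \in `[a, b] -> 0 <= \1_(B i) x * nu x.
  by move=> xab; rewrite mulr_ge0 ?nu0// indicE; case: (_ \in _).
rewrite ge0_integral_sum//; last 2 first.
- by move=> i; apply: emeasurable_funM => //; exact: mi.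
- by move=> i x xab; rewrite mule_ge0// lee_fin ?i0.
rewrite -sumEFin; apply: eq_bigr => i _.
rewrite ge0_integralZl_EFin//; last 2 first.
- by move=> x xab; rewrite lee_fin i0.
- exact: mi.
rewrite EFinM fineK ?fin_num_measure// mu_nu// setIC integral_mkcondr; congr (_ * _)%E.
apply: eq_integral => x _; rewrite patchE indicE.
by case: ifP => _; rewrite ?mul1r ?mul0r.
Qed.

Lemma density_integral (g : R -> R) : measurable_fun setT g -> (forall x, 0 <= g x) ->
  (\int[mu]_x (g x)%:E =
   \int[lebesgue_measure]_(x in `[a, b]) (g x * nu x)%:E)%E.
Proof.
move=> mg g0; have [mnu nu0 _] := nu_density.
have mEg : measurable_fun setT (EFin \o g) by apply/measurable_EFinP.
pose h := nnsfun_approx measurableT mEg.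
have mh n : measurable_fun [set: R] (h n : R -> R) by exact: measurable_funP.
have hg x : h n x @[n --> \oo] --> g x.
  have : (EFin \o h^~ x) @ \oo --> (g x)%:E.
    by apply: (cvg_nnsfun_approx measurableT mEg) => // y _; rewrite lee_fin.
  by move/fine_cvg.
have hnd x : nondecreasing_seq (h ^~ x).
  by move=> i j ij; exact/lefP/nd_nnsfun_approx.
have lim1 : (\int[mu]_x (h n x)%:E)%E @[n --> \oo] --> (\int[mu]_x (g x)%:E)%E.
  have E x : limn (fun n => (h n x)%:E) = (g x)%:E.
    by apply/cvg_lim => //; apply: cvg_EFin; [exact: nearW|exact: hg].
  under [X in _ --> X]eq_integral do rewrite -E.
  apply: cvg_monotone_convergence => //.
  - by move=> n; apply/measurable_EFinP; exact: measurable_funP.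
  - by move=> n x _; rewrite lee_fin.
  - by move=> x _ i j ij; rewrite lee_fin hnd.
have lim2 : (\int[lebesgue_measure]_(x in `[a, b]) (h n x * nu x)%:E)%E @[n --> \oo] -->
    (\int[lebesgue_measure]_(x in `[a, b]) (g x * nu x)%:E)%E.
  have E x : limn (fun n => (h n x * nu x)%:E) = (g x * nu x)%:E.
    apply/cvg_lim => //; apply: cvg_EFin; first exact: nearW.
    by apply: cvgM; [exact: hg|exact: cvg_cst].
  under [X in _ --> X]eq_integral do rewrite -E.
  apply: cvg_monotone_convergence => //.
  - move=> n; apply/measurable_EFinP; apply: measurable_funM => //.
    by apply: measurable_funTS; exact: mh.
  - by move=> n x xab; rewrite lee_fin mulr_ge0// nu0.
  - by move=> x xab i j ij; rewrite lee_fin ler_wpM2r ?nu0// hnd.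
rewrite (_ : (fun n => _) = (fun n => \int[lebesgue_measure]_(x in `[a, b])
    (h n x * nu x)%:E)%E) in lim1; last first.
  by apply/funext => n; exact: density_integral_simple.
exact: cvg_unique lim1 lim2.
Qed.

(** Adding the bound [M] makes the function nonnegative, where [density_integral] applies; both
    sides shift by [M] because the density has total mass 1. *)
Lemma density_mean (g : R -> R) (M v : R) : measurable_fun setT g ->
  (forall x, `|g x| <= M) ->
  (\int[lebesgue_measure]_(x in `[a, b]) (g x * nu x)%:E = v%:E)%E ->
  \int[mu]_x g x = v.
Proof.
move=> mg gM gv; have [mnu nu0 nu1] := nu_density.
have bg : bmeas g by split => //; exists M.
have bgM : bmeas (fun x => g x + M) by apply: bmeasD => //; exact: bmeas_cst.
have g0 x : 0 <= g x + M.
  by have := gM x; rewrite ler_norml => /andP[+ _]; lra.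
have inu : lebesgue_measure.-integrable `[a, b] (EFin \o nu).
  apply/integrableP; split; first exact/measurable_EFinP.
  rewrite [X in (X < _)%E](_ : _ = 1%E) ?ltry// -nu1.
  by apply: eq_integral => x /set_mem xab; rewrite /= ger0_norm// nu0.
have ign : lebesgue_measure.-integrable `[a, b] (fun x => (g x * nu x)%:E).
  have iM : lebesgue_measure.-integrable `[a, b] (fun x => M%:E * (EFin \o nu) x)%E.
    exact: integrableZl.
  apply: (le_integrable _ _ _ iM) => //.
  - by apply/measurable_EFinP; apply: measurable_funM => //; exact: measurable_funTS.
  - move=> x xab /=; rewrite lee_fin !normrM ler_wpM2r//.
    by apply: le_trans (gM x) _; exact: ler_norm.
have E : (\int[mu]_x (g x + M)%:E = (v + M)%:E)%E.
  rewrite (density_integral bgM.1 g0).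
  transitivity (\int[lebesgue_measure]_(x in `[a, b])
      ((g x * nu x)%:E + M%:E * (EFin \o nu) x))%E.
    by apply: eq_integral => x _; rewrite mulrDl EFinD EFinM.
  rewrite integralD//; last exact: integrableZl.
  by rewrite gv integralZl// nu1 mule1 EFinD.
have : \int[mu]_x (g x + M) = v + M.
  by apply: EFin_inj; rewrite -integral_mean.
rewrite RintegralD ?mean_cst//; first exact: addIr.
- exact: bmeas_integrable.
- exact: bmeas_integrable (bmeas_cst _).
Qed.

End Density.

(** * The error estimate *)

Section UniformNorm.
Context {R : realType}.
Implicit Types (a b : R) (f g : R -> R).

(** The value of [M] is immaterial: it certifies that the supremum is a true one. *)
Lemma norm_infty_ge a b g (M : R) x : (forall y, y \in `[a, b] -> `|g y| <= M) ->
  x \in `[a, b] -> `|g x| <= norm_infty a b g.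
Proof.
move=> gM xab; apply: ub_le_sup; last by exists x.
by exists M => _ [y /= yab <-]; exact: gM.
Qed.

Lemma norm_infty_le a b g (M : R) : a <= b ->
  (forall y, y \in `[a, b] -> `|g y| <= M) -> norm_infty a b g <= M.
Proof.
move=> ab gM; apply: ge_sup; last by move=> _ [y /= yab <-]; exact: gM.
by exists `|g a|; exists a => //=; rewrite in_itv/= lexx.
Qed.

(** This covers unbounded [g], where the default value of [sup] is 0, so the set defining
    [best_error] is always bounded below. *)
Lemma norm_infty_ge0 a b g : 0 <= norm_infty a b g.
Proof.
have [hs|hs] := pselect (has_sup [set `|g x| | x in `[a, b]]).
  have [[v gv] ub] := hs; apply: le_trans (ub_le_sup ub gv).
  by case: gv => x _ <-.
by rewrite /norm_infty sup_out.
Qed.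

Lemma horner_bounded a b (r : {poly R}) :
  exists M, forall x, x \in `[a, b] -> `|r.[x]| <= M.
Proof.
exists (\sum_(i < size r) `|r`_i| * (`|a| + `|b|) ^+ i) => x.
rewrite in_itv/= => /andP[ax xb]; rewrite horner_coef.
apply: le_trans (ler_norm_sum _ _ _) _; apply: ler_sum => i _.
rewrite normrM normrX ler_wpM2l// lerXn2r ?nnegrE ?addr_ge0//.
rewrite ler_norml; have := ler_norm b; have := ler_norm (- a); rewrite normrN.
by have := normr_ge0 a; have := normr_ge0 b; move=> *; apply/andP; split; lra.
Qed.

Lemma best_error_le a b N f (r : {poly R}) : (size r <= N.+1)%N ->
  best_error a b N f <= norm_infty a b (fun x => f x - r.[x]).
Proof.
move=> rN; apply: ge_inf; last by exists r.
by exists 0 => _ [q _ <-]; exact: norm_infty_ge0.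
Qed.

Lemma best_error_jackson a b (p N : nat) f (fp : R -> R) (M : R) : a < b ->
  nth_derivative_on a b p f fp -> (forall x, x \in `[a, b] -> `|fp x| <= M) ->
  (p <= N.+1)%N -> (0 < N)%N ->
  best_error a b N f <= p`!%:R * 2 ^+ p * (b - a) ^+ p * M / N%:R ^+ p.
Proof.
move=> ab ffp fpM pN N0; have [r rN rE] := jackson ab ffp fpM pN (ltn0Sn N).
apply: le_trans (best_error_le _ _ _ rN) _.
apply: norm_infty_le (ltW ab) _ => x xab; apply: le_trans (rE x xab) _.
have M0 : 0 <= M.
  by have := fpM a; rewrite in_itv/= lexx ltW//= => /(_ isT); apply: le_trans.
rewrite exprMn mulrA mulrAC ler_wpM2l//.
  by rewrite !mulr_ge0// exprn_ge0//; lra.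
rewrite lef_pV2 ?posrE ?exprn_gt0 ?ltr0n// lerXn2r ?nnegrE ?ler0n// ler_nat.
exact: leqnSn.
Qed.

(** Jackson's polynomial stays at bounded distance from [f], so [f] is bounded on [[a, b]]. This
    makes the supremum for $f-p_{opt}$ a genuine one. *)
Lemma sub_horner_bounded a b (p N : nat) f (fp : R -> R) (M : R) (q : {poly R}) : a < b ->
  nth_derivative_on a b p f fp -> (forall x, x \in `[a, b] -> `|fp x| <= M) ->
  (p <= N.+1)%N -> exists L, forall x, x \in `[a, b] -> `|f x - q.[x]| <= L.
Proof.
move=> ab ffp fpM pN; have [r _ rE] := jackson ab ffp fpM pN (ltn0Sn N).
have [L LE] := horner_bounded a b (r - q).
eexists => x xab; have -> : f x - q.[x] = (f x - r.[x]) + (r - q).[x].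
  by rewrite hornerD hornerN; ring.
by apply: le_trans (ler_normD _ _) _; apply: lerD; [exact: rE|exact: LE].
Qed.

End UniformNorm.

(** * Expansion of polynomials in the orthonormal system *)

Section Span.
Context {R : realType}.

Lemma span_of_size (phi : nat -> {poly R}) n (r : {poly R}) :
  (forall k, (k < n)%N -> size (phi k) = k.+1) -> (size r <= n)%N ->
  exists c : nat -> R, r = \sum_(k < n) c k *: phi k.
Proof.
elim: n r => [|n IH] r phiS rn.
  exists (fun=> 0); rewrite big_ord0; apply/eqP; rewrite -size_poly_eq0; lia.
have sn := phiS n (ltnSn n).
have ln : (phi n)`_n != 0.
  have : lead_coef (phi n) != 0 by rewrite lead_coef_eq0 -size_poly_eq0 sn.
  by rewrite lead_coefE sn.
pose z := r`_n / (phi n)`_n.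
have [|c rE] := IH (r - z *: phi n) (fun k kn => phiS k (ltnW kn)).
  apply/leq_sizeP => j; rewrite leq_eqVlt coefB coefZ => /predU1P[<-|nj].
    by rewrite /z divfK// subrr.
  rewrite (leq_sizeP _ _ rn)// (leq_sizeP _ _ (eq_leq sn))//.
  by rewrite mulr0 subrr.
exists (fun k => if k == n then z else c k).
rewrite big_ord_recr /= eqxx -[LHS](subrK (z *: phi n)) rE; congr (_ + _).
by apply: eq_bigr => k _; rewrite ltn_eqF.
Qed.

(** The $N+1$ sizes increase strictly from at least 1 to at most $N+1$, hence the size of [psi k] is
    exactly $k+1$ and leading terms can be eliminated one by one. *)
Lemma lincomb_of_size N (psi : 'I_N.+1 -> {poly R}) (r : {poly R}) :
  psi ord0 != 0 ->
  (forall j k : 'I_N.+1, (j < k)%N -> (size (psi j) < size (psi k))%N) ->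
  (forall k : 'I_N.+1, (size (psi k) <= N.+1)%N) ->
  (size r <= N.+1)%N -> r = lincomb psi (coefs psi r).
Proof.
move=> psi0 inc psiN rN.
pose phi k := psi (inord k).
have low k : (k < N.+1)%N -> (k < size (phi k))%N.
  elim: k => [_|k IH kN].
    rewrite size_poly_gt0 /phi (_ : inord 0 = ord0)//.
    by apply: val_inj; rewrite /= inordK.
  apply: leq_ltn_trans (IH (ltnW kN)) _; apply: inc.
  by rewrite !inordK// ltnW.
have up j : (j <= N)%N -> (size (phi (N - j)%N) <= N.+1 - j)%N.
  elim: j => [_|j IH jN]; first exact: psiN.
  have := IH (ltnW jN); have : (size (phi (N - j.+1)%N) < size (phi (N - j)%N))%N.
    by apply: inc; rewrite !inordK; lia.
  lia.
have phiS k : (k < N.+1)%N -> size (phi k) = k.+1.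
  move=> kN; apply/eqP; rewrite eqn_leq low// andbT.
  have := up (N - k)%N (leq_subr _ _); rewrite subKn//; lia.
have [c rE] := span_of_size phiS rN.
have : [set c' : 'cV[R]_N.+1 | r = lincomb psi c'] (\col_(k < N.+1) c k).
  rewrite /= {1}rE; apply: eq_bigr => k _; rewrite mxE /phi inord_val.
  by [].
by move/(xgetI 0).
Qed.

End Span.

(** * Lower bound on all vectors of small l1/l2 ratio *)

Section SparseLowerBound.
Context {R : realType} {d : measure_display} {T : measurableType d}.
Variables (P : probability T R) (m : nat) (X : 'I_m -> {RV P >-> R}).
Hypothesis indep : mutually_independent X.
Variable mu : probability R R.
Hypothesis Xmu : forall j (B : set R), measurable B -> distribution P (X j) B = mu B.
Variables (n : nat) (y : 'I_n -> R -> R) (K : R).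
Hypotheses (my : forall k, measurable_fun setT (y k))
  (yK : forall k x, `|y k x| <= K)
  (ortho : forall j k, \int[mu]_x (y j x * y k x) = (j == k)%:R).

(** After l1 normalization the ratio condition says that the squared l2 norm is at least $1/(16s)$.
    Of its quarter in [good_sample_lower_bound], the losses $1/(128s)$ consume at most half; the
    remaining eighth against 24 gives 192. *)
Lemma sparse_lower_bound (s : nat) (D : R) : (2 <= n)%N -> (2 <= s)%N -> 1 <= K ->
  194 <= D -> (forall x, 0 <= x -> 2 * (32 ^+ 2 * (338 * (64 * x))) <= D * x) ->
  512 * D * K ^+ 2 * s%:R * ln s%:R ^+ 3 * ln n%:R <= m%:R ->
  exists E : set T, [/\ measurable E,
    (P E <= (n%:R `^ (- (1 * ln s%:R ^+ 3)))%:E)%E &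
    forall w, ~ E w -> forall e : 'I_n -> R,
      (\sum_k `|e k|) ^+ 2 <= 16 * s%:R * \sum_k e k ^+ 2 ->
      m%:R * (\sum_k e k ^+ 2) <= 192 * \sum_j (\sum_k e k * y k (X j w)) ^+ 2].
Proof.
move=> n2 s2 K1 D194 D64 mC.
have K0 : 0 < K by apply: lt_le_trans K1.
have FB := failure_bound n2 s2 K1 D194 D64 mC.
have s0 : 0 < s%:R :> R by rewrite ltr0n; apply: leq_trans s2.
clear D194 D64 mC.
pose L := up_log 2 s.
have [E [mE PE HE]] := bad_event indep Xmu K0 my yK ortho (L + 12) L (tolerance s L).
exists E; split => //.
  by apply: le_trans PE _; rewrite lee_fin.
move=> w Ew e ratio; have [Hlow Hup] := HE w Ew.
set N := \sum_k `|e k| in ratio; set e2 := \sum_k _ in ratio *.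
have N0 : 0 <= N by exact: sumr_ge0.
have [NN|Nn0] := eqVneq N 0.
  have ek k : e k = 0.
    apply/eqP; rewrite -normr_eq0 eq_le normr_ge0 andbT -NN /N (bigD1 k)//= lerDl.
    by rewrite sumr_ge0.
  rewrite /e2 big1 => [|k _]; last by rewrite ek expr0n.
  by rewrite mulr0 mulr_ge0// sumr_ge0// => j _; exact: sqr_ge0.
have Npos : 0 < N by rewrite lt0r Nn0.
have e1 : \sum_k `|e k / N| = 1.
  under eq_bigr do rewrite normrM normfV (ger0_norm N0).
  by rewrite -mulr_suml divff.
have k2 : (2 <= L + 12)%N by rewrite addnC.
have := good_sample_lower_bound K0 my yK ortho k2 Hlow Hup e1.
have -> : \sum_k (e k / N) ^+ 2 = e2 / N ^+ 2.
  by rewrite /e2 mulr_suml; apply: eq_bigr => k _; rewrite expr_div_n.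
have -> : \sum_j (\sum_k e k / N * y k (X j w)) ^+ 2 =
    (\sum_j (\sum_k e k * y k (X j w)) ^+ 2) / N ^+ 2.
  rewrite mulr_suml; apply: eq_bigr => j _; rewrite -expr_div_n; congr (_ ^+ 2).
  by rewrite mulr_suml; apply: eq_bigr => k _; ring.
set Q := \sum_j (\sum_k e k * y k (X j w)) ^+ 2 => G.
have N2 : 0 < N ^+ 2 by rewrite exprn_gt0.
have EB : 13 / 4 * sampling_error (L + 12) L + \sum_(i < L.+1) tolerance s L i <=
    (128 * s%:R)^-1 :> R := @error_bound R s s2.
have r16 : (128 * s%:R)^-1 <= e2 / N ^+ 2 / 8.
  have -> : (128 * s%:R)^-1 = (16 * s%:R)^-1 / 8 :> R by field; rewrite gt_eqF.
  rewrite ler_pM2r// ler_pdivlMr// mulrC ler_pdivrMr; first by rewrite mulrC.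
  by rewrite mulr_gt0.
have : m%:R * (e2 / N ^+ 2 / 8) <= 24 * (Q / N ^+ 2).
  apply: le_trans G; apply: ler_wpM2l; first exact: ler0n.
  lra.
have -> : m%:R * (e2 / N ^+ 2 / 8) = m%:R * e2 / 8 / N ^+ 2 by ring.
rewrite mulrA ler_pM2r ?invr_gt0//; lra.
Qed.

End SparseLowerBound.

(** * The orthonormal system cut off outside the interval *)

Section Restriction.
Context {R : realType} (a b : R) (nu : R -> R) (mu : probability R R).
Hypothesis nu_density : prob_density a b nu.
Hypothesis mu_nu : forall B : set R, measurable B ->
  mu B = (\int[lebesgue_measure]_(x in B `&` `[a, b]) (nu x)%:E)%E.
Variables (n : nat) (psi : 'I_n -> {poly R}) (K : R).
Hypotheses (K_ge0 : 0 <= K) (psi_ortho : orthonormal_wrt a b nu psi)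
  (psiK : forall k, norm_infty a b (fun x => (psi k).[x]) <= K).

(* The law of a sample point only sees [a, b], but the tail bounds need [K] to
   bound the system on the whole line. *)
Definition restr (k : 'I_n) (x : R) : R := (psi k).[x] * \1_`[a, b] x.

Lemma restrE k x : x \in `[a, b] -> restr k x = (psi k).[x].
Proof. by move=> xab; rewrite /restr indicE mem_set// mulr1. Qed.

Lemma measurable_restr k : measurable_fun setT (restr k).
Proof.
apply: measurable_funM; last exact: measurable_indic.
by apply: continuous_measurable_fun; exact: continuous_horner.
Qed.

Lemma restr_le k x : `|restr k x| <= K.
Proof.
have [xab|xab] := boolP (x \in `[a, b]).
  rewrite restrE//; apply: le_trans (psiK k).
  by have [M HM] := horner_bounded a b (psi k); exact: norm_infty_ge HM xab.
rewrite /restr indicE memNset ?mulr0 ?normr0//.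
by apply/negP.
Qed.

Lemma restr_ortho j k : \int[mu]_x (restr j x * restr k x) = (j == k)%:R.
Proof.
apply: (density_mean nu_density mu_nu (M := K * K)).
- by apply: measurable_funM; exact: measurable_restr.
- by move=> x; rewrite normrM ler_pM ?restr_le.
rewrite -psi_ortho; apply: eq_integral => x /set_mem xab.
by rewrite !restrE.
Qed.

End Restriction.

(** * From the lower bound to the uniform error *)

Section ErrorEstimate.
Context {R : realType} (a b : R) (N m s : nat).
Variables (psi : 'I_N.+1 -> {poly R}) (K q : R) (Theta : nat).
Variables (f : R -> R) (popt : {poly R}) (x : 'I_m -> R) (c : 'cV[R]_N.+1).
Hypotheses (ab : a <= b) (m_gt0 : (0 < m)%N) (s_gt0 : (0 < s)%N)
  (Theta_gt0 : (0 < Theta)%N) (K_ge1 : 1 <= K) (q_gt0 : 0 < q) (q_lt1 : q < 1).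
Hypotheses (psiK : forall k y, y \in `[a, b] -> `|(psi k).[y]| <= K)
  (popt_span : popt = lincomb psi (coefs psi popt))
  (popt_error : forall y, y \in `[a, b] -> `|f y - popt.[y]| <= best_error a b N f)
  (error_ge0 : 0 <= best_error a b N f)
  (xab : forall j, x j \in `[a, b]).
Hypothesis lower_bound : forall e : 'I_N.+1 -> R,
  (\sum_k `|e k|) ^+ 2 <= 16 * s%:R * \sum_k e k ^+ 2 ->
  m%:R * (\sum_k e k ^+ 2) <= 192 * \sum_j (\sum_k e k * (psi k).[x j]) ^+ 2.
Hypothesis c_sol : l1_solution (sampling_mx psi x) (sample_vec f x)
  (Theta%:R * Num.sqrt m%:R * best_error a b N f) c.

Lemma sampling_lincomb z j : (sampling_mx psi x *m z) j 0 = (lincomb psi z).[x j].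
Proof.
rewrite mxE horner_sum; apply: eq_bigr => k _.
by rewrite mxE hornerZ mulrC.
Qed.

(** The coefficients of $p_{opt}$ are feasible because $\Theta\ge1$, so they compete with the
    minimizer; two feasible vectors have images at squared distance at most $4m(\Theta E_N)^2$.
    Recovery bounds their l1 distance, and $\|\psi_k\|_\infty\le K$ turns it into a uniform
    bound. *)
Lemma uniform_error_le : norm_infty a b (fun y => f y - (lincomb psi c).[y]) <=
  K * 4 * Anorm psi q popt * s%:R `^ (1 - q^-1) +
  best_error a b N f * (K * 112 * Theta%:R + 1) * Num.sqrt s%:R.
Proof.
set E := best_error a b N f; have E0 : 0 <= E := error_ge0.
pose co := coefs psi popt.
have m0 : 0 < m%:R :> R by rewrite ltr0n.
have T1 : 1 <= Theta%:R :> R by rewrite ler1n.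
have eta0 : 0 <= Theta%:R * Num.sqrt m%:R * E by rewrite !mulr_ge0// sqrtr_ge0.
have etaE : (Theta%:R * Num.sqrt m%:R * E) ^+ 2 = m%:R * (Theta%:R * E) ^+ 2.
  by rewrite !exprMn sqr_sqrtr//; ring.
have [cfeas cmin] := c_sol; rewrite -/E in cfeas cmin.
have res z j : (sampling_mx psi x *m z - sample_vec f x) j 0 = (lincomb psi z).[x j] - f (x j).
  by rewrite mxE sampling_lincomb !mxE.
have cofeas : vnorm 2 (sampling_mx psi x *m co - sample_vec f x) <=
    Theta%:R * Num.sqrt m%:R * E.
  rewrite vnorm2_le// etaE.
  apply: (@le_trans _ _ (\sum_(j < m) (Theta%:R * E) ^+ 2)).
    apply: ler_sum => j _; rewrite res -popt_span -[leLHS]real_normK ?num_real//.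
    apply: lerXn2r; rewrite ?nnegrE ?mulr_ge0// distrC.
    by apply: le_trans (popt_error (xab j)) _; rewrite ler_peMl.
  by rewrite sumr_const card_ord -[leLHS]mulr_natl.
pose e k := c k 0 - co k 0.
have [S Ss Ssum] := stechkin co q_gt0 q_lt1 s_gt0.
have nmin : \sum_k `|co k 0 + e k| <= \sum_k `|co k 0|.
  have := cmin _ cofeas; rewrite !vnorm1E; apply: le_trans.
  by apply: ler_sum => k _; rewrite /e addrC subrK.
have Qle : \sum_j (\sum_k e k * (psi k).[x j]) ^+ 2 <= 4 * m%:R * (Theta%:R * E) ^+ 2.
  rewrite vnorm2_le// etaE in cfeas; rewrite vnorm2_le// etaE in cofeas.
  apply: (@le_trans _ _ (\sum_j (2 * ((lincomb psi c).[x j] - f (x j)) ^+ 2 +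
      2 * ((lincomb psi co).[x j] - f (x j)) ^+ 2))).
    apply: ler_sum => j _.
    have -> : \sum_k e k * (psi k).[x j] = (lincomb psi c).[x j] - (lincomb psi co).[x j].
      rewrite /lincomb !horner_sum -sumrB; apply: eq_bigr => k _.
      by rewrite !hornerZ -mulrBl.
    set u := (lincomb psi c).[x j]; set v := (lincomb psi co).[x j]; set w := f _.
    by have := sqr_ge0 (u + v - 2 * w); move=> *; nra.
  rewrite big_split/= -!mulr_sumr.
  under eq_bigr do rewrite -res.
  under [X in _ + _ * X]eq_bigr do rewrite -res.
  by move: cfeas cofeas; lra.
have l1 := l1_recovery Ss m0 (mulr_ge0 (ler0n _ Theta) E0) nmin (@lower_bound e) Qle.
set n1 := \sum_k `|e k| in l1.
have sq1 : 1 <= Num.sqrt s%:R :> R.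
  by rewrite -[leLHS]sqrtr1 ler_sqrt ?ler0n// ler1n.
have K0 : 0 <= K by apply: le_trans K_ge1.
apply: norm_infty_le ab _ => y yab.
apply: (@le_trans _ _ (E + K * n1)).
  have -> : f y - (lincomb psi c).[y] = (f y - popt.[y]) - \sum_k e k * (psi k).[y].
    have -> : \sum_k e k * (psi k).[y] = (lincomb psi c).[y] - popt.[y].
      rewrite popt_span /lincomb !horner_sum -sumrB; apply: eq_bigr => k _.
      by rewrite !hornerZ -mulrBl.
    by ring.
  apply: le_trans (ler_normB _ _) _; apply: lerD; first exact: popt_error.
  apply: le_trans (ler_norm_sum _ _ _) _; rewrite mulr_sumr.
  by apply: ler_sum => k _; rewrite normrM mulrC ler_wpM2r// psiK.
have A1 : K * n1 <= K * (4 * (vnorm q co * s%:R `^ (1 - q^-1)) +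
    112 * Num.sqrt s%:R * (Theta%:R * E)).
  rewrite ler_wpM2l//; apply: le_trans l1 _; rewrite lerD2r ler_wpM2l//.
have A2 : E <= E * Num.sqrt s%:R by rewrite ler_peMr.
rewrite /Anorm -/co.
apply: le_trans (lerD A2 A1) _.
by rewrite le_eqVlt; apply/orP; left; apply/eqP; ring.
Qed.

End ErrorEstimate.

Theorem theorem3p2 (R : realType) :
  exists C0 D1 D2 gamma : R,
  [/\ 0 < C0, 0 < D1, 0 < D2 & 0 < gamma] /\
  forall p : nat, (2 <= p)%N ->
  exists Cp : R,
  forall (q : R) (Theta : nat) (a b : R) (nu : R -> R)
    (N m s : nat) (K : R) (psi : 'I_N.+1 -> {poly R})
    (d : measure_display) (T : measurableType d) (P : probability T R)
    (X : 'I_m -> {RV P >-> R})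
    (f fp : R -> R) (Mp : R) (popt : {poly R}),
    0 < q -> q < 1 ->
    (0 < Theta)%N ->
    a < b ->
    prob_density a b nu ->
    (0 < N)%N -> (0 < m)%N -> (0 < s)%N -> 1 <= K ->
    (* range of validity of Jackson's inequality E_N <= C_p (b-a)^p M_p / N^p *)
    (p <= N.+1)%N ->
    C0 * K ^+ 2 * s%:R * ln (s%:R : R) ^+ 3 * ln (N.+1%:R : R) <= m%:R ->
    orthonormal_wrt a b nu psi ->
    (forall j k : 'I_N.+1, (j < k)%N -> (size (psi j) < size (psi k))%N) ->
    (forall k : 'I_N.+1, (size (psi k) <= N.+1)%N) ->
    (forall k : 'I_N.+1, norm_infty a b (fun x => (psi k).[x]) <= K) ->
    mutually_independent X ->
    (forall j : 'I_m, has_density a b nu (X j)) ->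
    nth_derivative_on a b p f fp ->
    (forall x, x \in `[a, b] -> `|fp x| <= Mp) ->
    best_approx a b N f popt ->
    prob_at_least P
      [set w | forall c : 'cV[R]_N.+1,
         l1_solution (sampling_mx psi (fun j => X j w))
           (sample_vec f (fun j => X j w))
           (Theta%:R * Num.sqrt (m%:R) * best_error a b N f) c ->
         norm_infty a b (fun x => f x - (lincomb psi c).[x]) <=
           K * D1 * Anorm psi q popt * s%:R `^ (1 - q^-1) +
           Cp * (b - a) ^+ p * Mp * (K * D2 * Theta%:R + 1) *
             (Num.sqrt (s%:R) / N%:R ^+ p)]
      (1 - N.+1%:R `^ (- (gamma * ln (s%:R : R) ^+ 3))).
Proof.
(* The factors come from counting averages: $2n\le n^2$ gives 2, the length of an average $32^2$,
   and [samples_le] $338\cdot64$. *)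
pose D : R := 2 * (32 ^+ 2 * (338 * 64)).
have D194 : 194 <= D.
  rewrite /D -!natrX -!natrM ler_nat; exact: isT.
have D64 x : 0 <= x -> 2 * (32 ^+ 2 * (338 * (64 * x))) <= D * x.
  by move=> _; rewrite /D !mulrA.
have C0 : 0 < 512 * D.
  by apply: mulr_gt0; [rewrite ltr0n|apply: lt_le_trans D194; rewrite ltr0n].
exists (512 * D), 4, 112, 1; split; first by split.
clearbody D => p p2.
exists (p`!%:R * 2 ^+ p) => q Theta a b nu N m s K psi d T P X f fp Mp popt.
move=> q0 q1 Th0 ab nu_dens N0 m0 s0 K1 pN mC ortho inc psiN psiK indep dens ffp fpM.
move=> [popt_size popt_best].
(* For $s=1$ the logarithm vanishes, the claimed probability is $1-(N+1)^0=0$, and the empty event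
   will do. *)
have [s1|s2] := leqP s 1.
  have -> : s = 1%N by apply/eqP; rewrite eqn_leq s1 s0.
  exists set0; split=> //; rewrite measure0 ln1 expr0n/= mulr0 oppr0 powRr0 subrr.
  by [].
have K0 : 0 <= K by apply: le_trans K1.
pose mu := distribution P (X (Ordinal m0)).
have Xmu j (B : set R) : measurable B -> distribution P (X j) B = mu B.
  by move=> mB; rewrite /mu !dens.
have mu_nu (B : set R) : measurable B ->
    mu B = (\int[lebesgue_measure]_(x in B `&` `[a, b]) (nu x)%:E)%E.
  by move=> mB; exact: dens.
have [E1 [mE1 PE1 LB]] := sparse_lower_bound indep Xmu (measurable_restr a b psi)
  (restr_le K0 psiK) (restr_ortho nu_dens mu_nu K0 ortho psiK) (N0 : (2 <= N.+1)%N)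
  s2 K1 D194 D64 mC.
(* The sample points are real random variables, in [[a, b]] only almost surely; the exceptional null
   event is discarded as well. *)
pose F j := X j @^-1` (~` `[a, b]).
have mab : measurable (~` `[a, b] : set R) by exact: measurableC.
have mF j : measurable (F j).
  by rewrite -[X in measurable X]setTI; exact: measurable_funP.
have PF j : (P (F j) <= 0%:E)%E.
  by rewrite -[P (F j)]/(distribution P (X j) _) dens// setICl integral_set0.
have [E2 [mE2 FE2 PE2]] := union_bound mF PF.
have mE : measurable (E1 `|` E2) by exact: measurableU.
exists (~` (E1 `|` E2)); split; first exact: measurableC.
- move=> w Ew c csol.
  have E1w : ~ E1 w by move=> h; apply: Ew; left.
  have xab j : X j w \in `[a, b].
    by apply/negPn/negP => /negP h; apply: Ew; right; exact: (FE2 j).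
  have psi_le k z : z \in `[a, b] -> `|(psi k).[z]| <= K.
    move=> zab; apply: le_trans (psiK k).
    by have [M HM] := horner_bounded a b (psi k); exact: norm_infty_ge HM zab.
  (* Strictly increasing sizes would still allow a zero first polynomial; its unit norm excludes
     it. *)
  have psi0 : psi ord0 != 0.
    apply/eqP => psi0; have := ortho ord0 ord0; rewrite psi0.
    under eq_integral do rewrite horner0 !mul0r.
    by rewrite integral0 eqxx => /(congr1 fine)/eqP; rewrite /= eq_sym oner_eq0.
  have span := lincomb_of_size psi0 inc psiN popt_size.
  have perr z : z \in `[a, b] -> `|f z - popt.[z]| <= best_error a b N f.
    move=> zab; rewrite -popt_best.
    have [M HM] := sub_horner_bounded popt ab ffp fpM pN.
    exact: (norm_infty_ge HM zab).
  have err0 : 0 <= best_error a b N f by rewrite -popt_best norm_infty_ge0.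
  have lb (e : 'I_N.+1 -> R) : (\sum_k `|e k|) ^+ 2 <= 16 * s%:R * \sum_k e k ^+ 2 ->
      m%:R * (\sum_k e k ^+ 2) <= 192 * \sum_j (\sum_k e k * (psi k).[X j w]) ^+ 2.
    move=> /(LB w E1w) /le_trans; apply; apply: ler_wpM2l; first exact: ler0n.
    apply: ler_sum => j _; rewrite le_eqVlt; apply/orP; left; apply/eqP.
    by congr (_ ^+ 2); apply: eq_bigr => k _; rewrite restrE.
  have := uniform_error_le (ltW ab) m0 s0 Th0 K1 q0 q1 psi_le span perr err0 xab lb csol.
  move=> /le_trans; apply; rewrite lerD2l.
  have J := best_error_jackson ab ffp fpM pN N0.
  rewrite [leRHS](_ : _ = p`!%:R * 2 ^+ p * (b - a) ^+ p * Mp / N%:R ^+ p *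
    (K * 112 * Theta%:R + 1) * Num.sqrt s%:R); last by ring.
  by rewrite ler_wpM2r ?sqrtr_ge0// ler_wpM2r// addr_ge0// !mulr_ge0.
- rewrite probability_setC// EFinB leeB//.
  apply: le_trans (measureU2 _ mE1 mE2) _.
  rewrite -[leRHS]adde0; apply: leeD PE1 _.
  by move: PE2; rewrite big1.
Qed.
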